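(* Let $R$ be a Ding-Chen ring, that is, a left and right coherent ring which has finite FP-injective dimension both as a left and as a right module over itself. Then for a left $R$-module $M$ the following are equivalent: $M$ is trivial in the Gorenstein flat model structure on $R$-Mod; $M$ has finite flat dimension; $M$ has finite FP-injective dimension. In the case that $R$ is Gorenstein, these conditions are also equivalent to $M$ having finite injective dimension, and also equivalent to $M$ having finite projective dimension.
   Context: Rings have an identity and modules are unital. ''Module'' means left $R$-module unless stated otherwise. A module $N$ is FP-injective (absolutely pure) if $\operatorname{Ext}^1_R(P,N)=0$ for every finitely presented module $P$; the FP-injective dimension of $N$ is the least $n\ge 0$ such that $\operatorname{Ext}^{n+1}_R(P,N)=0$ for all finitely presented $P$ (and $\infty$ if there is no such $n$). A Gorenstein ring is a left and right Noetherian ring having finite injective dimension both as a left and as a right module over itself. For a class $\mathcal{S}$ of left $R$-modules, $\mathcal{S}^{\perp}$ is the class of all modules $N$ with $\operatorname{Ext}^1_R(S,N)=0$ for all $S\in\mathcal{S}$. $\mathcal{F}$ is the class of flat left $R$-modules and $\mathcal{C}=\mathcal{F}^{\perp}$ the class of cotorsion modules. A complete flat resolution is an exact chain complex $F=\cdots\to F_1\to F_0\to F_{-1}\to F_{-2}\to\cdots$ of flat left $R$-modules such that $I\otimes_R F$ is exact for every injective right $R$-module $I$. A left $R$-module $M$ is Gorenstein flat if $M=Z_{-1}F=\ker(F_{-1}\to F_{-2})$ for some complete flat resolution $F$. $\mathcal{GF}$ is the class of Gorenstein flat modules, and $\mathcal{GC}=\mathcal{GF}^{\perp}$ the class of Gorenstein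 cotorsion modules. A model structure on an abelian category is abelian if the (trivial) cofibrations are exactly the monomorphisms with (trivially) cofibrant cokernel and the (trivial) fibrations are exactly the epimorphisms with (trivially) fibrant kernel; an object $X$ is trivial if $0\to X$ is a weak equivalence. For any right coherent ring $R$, the Gorenstein flat model structure is the abelian model structure on $R$-Mod whose cofibrant objects are the class $\mathcal{GF}$, fibrant objects the class $\mathcal{C}$, trivially cofibrant objects the class $\mathcal{F}$, and trivially fibrant objects the class $\mathcal{GC}$. Its trivial objects are the modules $M$ admitting a short exact sequence $0\to C\to F\to M\to 0$ with $F\in\mathcal{F}$, $C\in\mathcal{GC}$ (equivalently, a short exact sequence $0\to M\to C'\to F'\to 0$ with $F'\in\mathcal{F}$, $C'\in\mathcal{GC}$). *)

(* Defs.v *)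
From HB Require Import structures.
From mathcomp Require Import all_boot all_algebra.
From mathcomp Require Import boolp.

Set Implicit Arguments.
Unset Strict Implicit.
Unset Printing Implicit Defensive.

Import GRing.Theory.
Local Open Scope ring_scope.
Local Open Scope quotient_scope.

(* A ring is an [R : pzRingType] (the zero ring is allowed), a left R-module an
   [lmodType R], and a right R-module an [lmodType R^c]; in the latter [a *: m]
   stands for [m a].  The regular left and right modules are [R^o] and
   [(R^c)^o].  Ring-theoretic conditions on the right are the left conditions
   for [R^c]. *)

(** Exactness *)

Definition surjective (A B : Type) (f : A -> B) : Prop :=
  forall y, exists x, f x = y.

Definition exact (A B C : zmodType) (f : A -> B) (g : B -> C) : Prop :=
  forall y, g y = 0 <-> exists x, f x = y.

Definition short_exact (R : pzRingType) (A B C : lmodType R)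
    (f : {linear A -> B}) (g : {linear B -> C}) : Prop :=
  [/\ injective f, exact f g & surjective g].

(** Tensor product of a right and a left module *)

(* The formal sum [:: (m_1, n_1); ...; (m_k, n_k)] stands for the sum of the
   tensors of m_i and n_i.  Formal sums are elements of a free monoid, not of a
   free group, which is why [tens0] has to be imposed; it yields the opposite
   of the tensor of m and n as the tensor of -m and n. *)
Inductive tensor_rel (R : pzRingType) (M : lmodType R^c) (N : lmodType R) :
    seq (M * N) -> seq (M * N) -> Prop :=
| tens_refl s : tensor_rel s s
| tens_sym s t : tensor_rel s t -> tensor_rel t s
| tens_trans s t u : tensor_rel s t -> tensor_rel t u -> tensor_rel s u
| tens_cat s s' t t' :
    tensor_rel s s' -> tensor_rel t t' -> tensor_rel (s ++ t) (s' ++ t')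
| tens_comm s t : tensor_rel (s ++ t) (t ++ s)
| tens0 n : tensor_rel [:: (0, n)] [::]
| tensDl m m' n : tensor_rel [:: (m + m', n)] [:: (m, n); (m', n)]
| tensDr m n n' : tensor_rel [:: (m, n + n')] [:: (m, n); (m, n')]
| tensA (a : R) m n :
    tensor_rel [:: ((a : R^c) *: m, n)] [:: (m, a *: n)].

Definition tensor_relb (R : pzRingType) (M : lmodType R^c) (N : lmodType R) :
  rel (seq (M * N)) := fun s t => `[< tensor_rel s t >].

Lemma tensor_relb_equiv (R : pzRingType) (M : lmodType R^c) (N : lmodType R) :
  equiv_class_of (@tensor_relb R M N).
Proof.
split=> [s|s t|t s u]; rewrite /tensor_relb.
- exact/asboolP/tens_refl.
- by apply/asboolP/asboolP; apply: tens_sym.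
- by move=> /asboolP st /asboolP tu; apply/asboolP; apply: tens_trans tu.
Qed.

Canonical tensor_relb_equiv_rel (R : pzRingType) (M : lmodType R^c)
  (N : lmodType R) := EquivRelPack (@tensor_relb_equiv R M N).
Canonical tensor_relb_encModRel (R : pzRingType) (M : lmodType R^c)
  (N : lmodType R) := defaultEncModRel (@tensor_relb R M N).

Definition tensor (R : pzRingType) (M : lmodType R^c) (N : lmodType R) : Type :=
  {eq_quot @tensor_relb R M N}.

Section TensorZmodule.
Context {R : pzRingType} {M : lmodType R^c} {N : lmodType R}.
Implicit Types s t : seq (M * N).

HB.instance Definition _ := Choice.on (tensor M N).

Definition tensor_class s : tensor M N := \pi_{eq_quot @tensor_relb R M N} s.

Lemma tensor_classP s t : tensor_class s = tensor_class t <-> tensor_rel s t.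
Proof. by split=> [/eqmodP/asboolP//|st]; exact/eqmodP/asboolP. Qed.

Lemma tensor_class_repr (x : tensor M N) : tensor_class (repr x) = x.
Proof. exact: reprK. Qed.

Definition tensor_zero : tensor M N := tensor_class [::].
Definition tensor_add (x y : tensor M N) : tensor M N :=
  tensor_class (repr x ++ repr y).
Definition tensor_opp (x : tensor M N) : tensor M N :=
  tensor_class [seq (- p.1, p.2) | p <- repr x].

Lemma tensor_rel_repr s : tensor_rel (repr (tensor_class s)) s.
Proof. by apply/tensor_classP; rewrite tensor_class_repr. Qed.

Lemma tensor_addE s t :
  tensor_add (tensor_class s) (tensor_class t) = tensor_class (s ++ t).
Proof. by apply/tensor_classP/tens_cat; apply: tensor_rel_repr. Qed.

Lemma tensor_addA : associative tensor_add.
Proof.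
move=> x y z; rewrite -(tensor_class_repr x) -(tensor_class_repr y).
by rewrite -(tensor_class_repr z) !tensor_addE catA.
Qed.

Lemma tensor_addC : commutative tensor_add.
Proof. by move=> x y; apply/tensor_classP/tens_comm. Qed.

Lemma tensor_add0 : left_id tensor_zero tensor_add.
Proof. by move=> x; rewrite -(tensor_class_repr x) tensor_addE. Qed.

Lemma tensor_addN : left_inverse tensor_zero tensor_opp tensor_add.
Proof.
move=> x; rewrite -[in X in tensor_add _ X](tensor_class_repr x) tensor_addE.
apply/tensor_classP; elim: (repr x) => [|[m n] s IHs] /=; first exact: tens_refl.
apply: (@tens_trans _ _ _ _ [:: (- m, n); (m, n)]); last first.
  apply: (@tens_trans _ _ _ _ [:: (0, n)]); last exact: tens0.
  apply: tens_sym.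
  by rewrite -(addNr m); apply: tensDl.
suff rel_mid : tensor_rel ([seq (- p.1, p.2) | p <- s] ++ (m, n) :: s)
                          [:: (m, n)].
  exact: (tens_cat (tens_refl [:: (- m, n)]) rel_mid).
apply: (@tens_trans _ _ _ _
  (([:: (m, n)] ++ [seq (- p.1, p.2) | p <- s]) ++ s)).
  rewrite -cat_rcons -cats1.
  exact: (tens_cat (tens_comm _ [:: (m, n)]) (tens_refl s)).
by rewrite -catA; apply: (tens_cat (tens_refl [:: (m, n)]) IHs).
Qed.

HB.instance Definition _ := GRing.isZmodule.Build (tensor M N)
  tensor_addA tensor_addC tensor_add0 tensor_addN.

End TensorZmodule.

Definition tensor_map (R : pzRingType) (M M' : lmodType R^c)
    (N N' : lmodType R) (f : {linear M -> M'}) (g : {linear N -> N'})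
    (x : tensor M N) : tensor M' N' :=
  tensor_class [seq (f p.1, g p.2) | p <- repr x].

Lemma tensor_mapE (R : pzRingType) (M M' : lmodType R^c) (N N' : lmodType R)
    (f : {linear M -> M'}) (g : {linear N -> N'}) (s : seq (M * N)) :
  tensor_map f g (tensor_class s) = tensor_class [seq (f p.1, g p.2) | p <- s].
Proof.
have map_rel s1 s2 : tensor_rel s1 s2 ->
    tensor_rel [seq (f p.1, g p.2) | p <- s1] [seq (f p.1, g p.2) | p <- s2].
  elim=> {s1 s2} [s1|s1 s2 _|s1 s2 s3 _ IH12 _|s1 s2 s3 s4 _ IH12 _ IH34|s1 s2|n|||] /=.
  - exact: tens_refl.
  - exact: tens_sym.
  - exact: (tens_trans IH12).
  - by rewrite !map_cat; apply: tens_cat.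
  - by rewrite !map_cat; apply: tens_comm.
  - by rewrite linear0; apply: tens0.
  - by move=> m m' n; rewrite linearD; apply: tensDl.
  - by move=> m n n'; rewrite linearD; apply: tensDr.
  - by move=> a m n; rewrite !linearZ; apply: tensA.
by apply/tensor_classP/map_rel/tensor_rel_repr.
Qed.

(** Projective, injective, flat, finitely presented modules *)

Definition projective (R : pzRingType) (P : lmodType R) : Prop :=
  forall (A B : lmodType R) (p : {linear A -> B}) (f : {linear P -> B}),
    surjective p -> exists g : {linear P -> A}, p \o g =1 f.

Definition injective_module (R : pzRingType) (I : lmodType R) : Prop :=
  forall (A B : lmodType R) (i : {linear A -> B}) (f : {linear A -> I}),
    injective i -> exists g : {linear B -> I}, g \o i =1 f.

Definition flat (R : pzRingType) (N : lmodType R) : Prop :=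
  forall (A B : lmodType R^c) (i : {linear A -> B}),
    injective i -> injective (tensor_map i (idfun : {linear N -> N})).

Definition finitely_generated (R : pzRingType) (M : lmodType R) : Prop :=
  exists (n : nat) (p : {linear 'rV[R]_n -> M}), surjective p.

Definition finitely_presented (R : pzRingType) (M : lmodType R) : Prop :=
  exists (m n : nat) (f : {linear 'rV[R]_m -> 'rV[R]_n})
    (p : {linear 'rV[R]_n -> M}), exact f p /\ surjective p.

(** Resolutions and Ext *)

Record left_resolution (R : pzRingType) (M : lmodType R) := LeftResolution {
  lres :> nat -> lmodType R;
  ldiff : forall i, {linear lres i.+1 -> lres i};
  laug : {linear lres 0%N -> M};
  laug_surj : surjective laug;
  laug_exact : exact (ldiff 0) laug;
  ldiff_exact : forall i, exact (ldiff i.+1) (ldiff i) }.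

Record right_resolution (R : pzRingType) (M : lmodType R) := RightResolution {
  rres :> nat -> lmodType R;
  rdiff : forall i, {linear rres i -> rres i.+1};
  raug : {linear M -> rres 0%N};
  raug_inj : injective raug;
  raug_exact : exact raug (rdiff 0);
  rdiff_exact : forall i, exact (rdiff i) (rdiff i.+1) }.

(* Ext^{n+1}(A, N) = 0: the complex Hom(P, N) is exact in degree n+1 for the
   projective resolutions P of A. *)
Definition ExtS_vanishes (R : pzRingType) (n : nat) (A N : lmodType R) : Prop :=
  forall P : left_resolution A, (forall i, projective (P i)) ->
  forall f : {linear P n.+1 -> N}, (forall x, f (ldiff P n.+1 x) = 0) ->
  exists g : {linear P n -> N}, f =1 g \o ldiff P n.

Definition Ext1_vanishes (R : pzRingType) (A N : lmodType R) : Prop :=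
  ExtS_vanishes 0 A N.

Definition right_orthogonal (R : pzRingType) (S : lmodType R -> Prop)
    (N : lmodType R) : Prop :=
  forall A : lmodType R, S A -> Ext1_vanishes A N.

(** Homological dimensions *)

Definition finite_left_dim (R : pzRingType) (S : lmodType R -> Prop)
    (M : lmodType R) : Prop :=
  exists (n : nat) (P : left_resolution M),
    (forall i, S (P i)) /\ (forall i, (n < i)%N -> forall x : P i, x = 0).

Definition finite_flat_dim (R : pzRingType) (M : lmodType R) : Prop :=
  finite_left_dim (@flat R) M.

Definition finite_projective_dim (R : pzRingType) (M : lmodType R) : Prop :=
  finite_left_dim (@projective R) M.

Definition finite_injective_dim (R : pzRingType) (M : lmodType R) : Prop :=
  exists (n : nat) (I : right_resolution M),
    (forall i, injective_module (I i)) /\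
    (forall i, (n < i)%N -> forall x : I i, x = 0).

Definition finite_FP_injective_dim (R : pzRingType) (N : lmodType R) : Prop :=
  exists n : nat, forall P : lmodType R,
    finitely_presented P -> ExtS_vanishes n P N.

(** Rings *)

Definition left_noetherian (R : pzRingType) : Prop :=
  forall (I : lmodType R) (j : {linear I -> R^o}),
    injective j -> finitely_generated I.

Definition left_coherent (R : pzRingType) : Prop :=
  forall (I : lmodType R) (j : {linear I -> R^o}),
    injective j -> finitely_generated I -> finitely_presented I.

Definition ding_chen (R : pzRingType) : Prop :=
  [/\ left_coherent R, left_coherent R^c,
      finite_FP_injective_dim (R^o : lmodType R)
    & finite_FP_injective_dim ((R^c)^o : lmodType R^c)].

Definition gorenstein (R : pzRingType) : Prop :=
  [/\ left_noetherian R, left_noetherian R^c,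
      finite_injective_dim (R^o : lmodType R)
    & finite_injective_dim ((R^c)^o : lmodType R^c)].

(** Gorenstein flat, cotorsion and Gorenstein cotorsion modules *)

Record complete_flat_resolution (R : pzRingType) := CompleteFlatResolution {
  cfr :> int -> lmodType R;
  cdiff : forall i : int, {linear cfr i -> cfr (i - 1)};
  cfr_flat : forall i, flat (cfr i);
  cfr_exact : forall i, exact (cdiff i) (cdiff (i - 1));
  cfr_tensor_exact : forall I : lmodType R^c, injective_module I ->
    forall i, exact (tensor_map (idfun : {linear I -> I}) (cdiff i))
                    (tensor_map (idfun : {linear I -> I}) (cdiff (i - 1))) }.

(* M is (isomorphic, through j, to) the kernel of F_{-1} -> F_{-2}. *)
Definition gorenstein_flat (R : pzRingType) (M : lmodType R) : Prop :=
  exists (F : complete_flat_resolution R) (j : {linear M -> F (-1)}),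
    injective j /\ exact j (cdiff F (-1)).

Definition cotorsion (R : pzRingType) : lmodType R -> Prop :=
  right_orthogonal (@flat R).

Definition gorenstein_cotorsion (R : pzRingType) : lmodType R -> Prop :=
  right_orthogonal (@gorenstein_flat R).

(** Model structures on R-Mod *)

Definition morphism_class (R : pzRingType) : Type :=
  forall A B : lmodType R, {linear A -> B} -> Prop.

Definition classI (R : pzRingType) (S T : morphism_class R) :
  morphism_class R := fun A B f => S A B f /\ T A B f.

Definition two_of_three (R : pzRingType) (W : morphism_class R) : Prop :=
  forall (A B C : lmodType R) (f : {linear A -> B}) (g : {linear B -> C})
    (h : {linear A -> C}), h =1 g \o f ->
  [/\ W A B f -> W B C g -> W A C h,
      W A B f -> W A C h -> W B C g
    & W B C g -> W A C h -> W A B f].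

Definition retract (R : pzRingType) (A B C D : lmodType R)
    (f : {linear A -> B}) (g : {linear C -> D}) : Prop :=
  exists (i : {linear A -> C}) (r : {linear C -> A})
    (i' : {linear B -> D}) (r' : {linear D -> B}),
  [/\ r \o i =1 id, r' \o i' =1 id, g \o i =1 i' \o f & f \o r =1 r' \o g].

Definition retract_closed (R : pzRingType) (S : morphism_class R) : Prop :=
  forall (A B C D : lmodType R) (f : {linear A -> B}) (g : {linear C -> D}),
    retract f g -> S C D g -> S A B f.

Definition lifting (R : pzRingType) (S T : morphism_class R) : Prop :=
  forall (A B X Y : lmodType R) (i : {linear A -> B}) (p : {linear X -> Y})
    (u : {linear A -> X}) (v : {linear B -> Y}),
  S A B i -> T X Y p -> p \o u =1 v \o i ->
  exists h : {linear B -> X}, h \o i =1 u /\ p \o h =1 v.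

Definition factorization (R : pzRingType) (S T : morphism_class R) : Prop :=
  forall (A B : lmodType R) (f : {linear A -> B}),
  exists (C : lmodType R) (i : {linear A -> C}) (p : {linear C -> B}),
    [/\ S A C i, T C B p & f =1 p \o i].

Record model_structure (R : pzRingType) := ModelStructure {
  weq : morphism_class R;
  cof : morphism_class R;
  fib : morphism_class R;
  weq_two_of_three : two_of_three weq;
  weq_retract : retract_closed weq;
  cof_retract : retract_closed cof;
  fib_retract : retract_closed fib;
  tcof_fib_lifting : lifting (classI cof weq) fib;
  cof_tfib_lifting : lifting cof (classI fib weq);
  tcof_fib_factorization : factorization (classI cof weq) fib;
  cof_tfib_factorization : factorization cof (classI fib weq) }.

(* 'rV[R]_0 is the zero module. *)
Definition from_zero (R : pzRingType) (X : lmodType R) :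
  {linear 'rV[R]_0 -> X} := \0.

Definition to_zero (R : pzRingType) (X : lmodType R) :
  {linear X -> 'rV[R]_0} := \0.

Definition cofibrant (R : pzRingType) (ms : model_structure R)
    (X : lmodType R) : Prop := cof ms (from_zero X).

Definition fibrant (R : pzRingType) (ms : model_structure R)
    (X : lmodType R) : Prop := fib ms (to_zero X).

Definition trivial_object (R : pzRingType) (ms : model_structure R)
    (X : lmodType R) : Prop := weq ms (from_zero X).

Definition trivially_cofibrant (R : pzRingType) (ms : model_structure R)
    (X : lmodType R) : Prop := cofibrant ms X /\ trivial_object ms X.

Definition trivially_fibrant (R : pzRingType) (ms : model_structure R)
    (X : lmodType R) : Prop := fibrant ms X /\ trivial_object ms X.

Definition mono_with_cokernel_in (R : pzRingType) (S : lmodType R -> Prop)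
    (A B : lmodType R) (f : {linear A -> B}) : Prop :=
  exists (C : lmodType R) (q : {linear B -> C}), short_exact f q /\ S C.

Definition epi_with_kernel_in (R : pzRingType) (S : lmodType R -> Prop)
    (A B : lmodType R) (f : {linear A -> B}) : Prop :=
  exists (K : lmodType R) (k : {linear K -> A}), short_exact k f /\ S K.

Definition abelian_model_structure (R : pzRingType) (ms : model_structure R) :
    Prop :=
  forall (A B : lmodType R) (f : {linear A -> B}),
  [/\ cof ms f <-> mono_with_cokernel_in (cofibrant ms) f,
      classI (cof ms) (weq ms) f <->
        mono_with_cokernel_in (trivially_cofibrant ms) f,
      fib ms f <-> epi_with_kernel_in (fibrant ms) f
    & classI (fib ms) (weq ms) f <->
        epi_with_kernel_in (trivially_fibrant ms) f].

Definition gorenstein_flat_model_structure (R : pzRingType)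
    (ms : model_structure R) : Prop :=
  abelian_model_structure ms /\
  forall X : lmodType R,
  [/\ cofibrant ms X <-> gorenstein_flat X,
      fibrant ms X <-> cotorsion X,
      trivially_cofibrant ms X <-> flat X
    & trivially_fibrant ms X <-> gorenstein_cotorsion X].

(* Main.v *)
From HB Require Import structures.
Require Import Defs.
From mathcomp Require Import all_boot all_algebra.
From mathcomp Require Import boolp classical_sets functions.

(** The theorem reduces to linear algebra over R. Over a coherent ring the
solutions of a system of linear equations are generated by finitely many, so
finitely presented modules have resolutions given by matrices, and Ext and Tor
with them are computed by complexes of the form M^c -> M^b -> M^a whose maps
are matrices ([act_exact]). FP-injective dimension at most n becomes exactness
of these complexes beyond degree n ([FPdim_le]), and flatness becomes the
equational criterion ([lifts_relations]), by which a flat module keeps exact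
whatever sequence of matrices is exact on columns. Let n and m bound the
FP-injective dimension of R as a left and as a right module.

Finite flat dimension gives FP-injective dimension at most n: this holds for R,
hence for flat modules, hence for modules with a finite flat resolution, by the
long exact sequence. Conversely, resolve a finitely presented right module by
columns. As R has FP-injective dimension at most m on the right, the resolution
is exact on rows from the m-th step on, and read backwards it resolves finitely
presented left modules. Hence Tor_(m+1) of the right module with M is an Ext of
arbitrarily high degree to M, and vanishes if M has finite FP-injective
dimension; so the m-th syzygies of M are flat ([flat_syzygy_of_FPdim]).

For the model structure, continue a resolution of a finitely presented module,
from the n-th syzygy on, to both sides by row and by column kernels. The two
bounds make the result exact on rows and on columns, so it is a complete flat
resolution ([gorenstein_flat_coker]): n-th syzygies of finitely presented
modules are Gorenstein flat, and Gorenstein cotorsion modules have FP-injective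
dimension at most n ([gorenstein_cotorsion_FPdim]). A cofibrant replacement of
M is an exact sequence 0 -> K -> X -> M -> 0 with X Gorenstein flat and K
Gorenstein cotorsion, and M is trivial if and only if X is flat. If X is flat,
then M has finite dimension because K has. If M has finite dimension, then so
has X; but X is an m-th syzygy in a complex of flat modules whose cycles all
have dimension at most n, so it is flat.

If R is left noetherian, Baer's criterion turns FP-injective dimension at most
n into injective dimension at most n ([FPdim_injdim]). If M has finite flat
dimension, then so have its syzygies; hence Ext^(n+1) from M to its (n+1)-st
syzygy vanishes, the n-th syzygy is a direct summand of a free module, and M
has finite projective dimension. *)

Set Implicit Arguments.
Unset Strict Implicit.
Unset Printing Implicit Defensive.

Import GRing.Theory.
Local Open Scope ring_scope.

(** * Submodules, quotients and maps *)

Definition linear_map (R : pzRingType) (U V : lmodType R) (f : U -> V)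
    (lin_f : linear f) : {linear U -> V} :=
  HB.pack f (GRing.isLinear.Build R U V *:%R f lin_f).
Arguments linear_map : simpl never.

Lemma linear_ext (R : pzRingType) (U V : lmodType R) (f g : {linear U -> V}) :
  f =1 g -> f = g.
Proof.
move: f g => [f cf] [g cg] /= /funext fg; subst g; congr GRing.Linear.Pack.
case: cf cg => [[a1] [b1]] [[a2] [b2]].
by rewrite (Prop_irrelevance a1 a2) (Prop_irrelevance b1 b2).
Qed.

Definition is_submodule (R : pzRingType) (V : lmodType R) (P : V -> Prop) :=
  P 0 /\ forall a x y, P x -> P y -> P (a *: x + y).

Section SubmoduleTheory.
Variables (R : pzRingType) (V : lmodType R) (P : V -> Prop).
Hypothesis hP : is_submodule P.

Lemma submodule0 : P 0. Proof. by case: hP. Qed.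
Lemma submoduleP a x y : P x -> P y -> P (a *: x + y). Proof. exact: hP.2. Qed.
Lemma submoduleZ a x : P x -> P (a *: x).
Proof. by move=> Px; rewrite -[_ *: _]addr0; apply: submoduleP submodule0. Qed.
Lemma submoduleD x y : P x -> P y -> P (x + y).
Proof. by rewrite -{2}[x]scale1r; apply: submoduleP. Qed.
Lemma submoduleN x : P x -> P (- x).
Proof. by rewrite -scaleN1r; apply: submoduleZ. Qed.
End SubmoduleTheory.

Definition submodule (R : pzRingType) (V : lmodType R) (P : V -> Prop)
  & is_submodule P : Type := {x : V | `[< P x >]}.

Section Submodule.
Variables (R : pzRingType) (V : lmodType R) (P : V -> Prop).
Variable hP : is_submodule P.
Let U := submodule hP.

HB.instance Definition _ := Choice.on U.

Definition sub_val (x : U) : V := sval x.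
Definition to_sub (x : V) (Px : P x) : U := exist _ x (asboolT Px).

Lemma sub_val_inj : injective sub_val. Proof. exact: val_inj. Qed.
Lemma sub_valP x : P (sub_val x). Proof. exact: asboolW (svalP x). Qed.

Definition sub_zero : U := to_sub (submodule0 hP).
Definition sub_opp (x : U) : U := to_sub (submoduleN hP (sub_valP x)).
Definition sub_add (x y : U) : U :=
  to_sub (submoduleD hP (sub_valP x) (sub_valP y)).
Definition sub_scale a (x : U) : U := to_sub (submoduleZ hP a (sub_valP x)).

Fact sub_addA : associative sub_add.
Proof. by move=> x y z; apply: sub_val_inj; apply: addrA. Qed.
Fact sub_addC : commutative sub_add.
Proof. by move=> x y; apply: sub_val_inj; apply: addrC. Qed.
Fact sub_add0 : left_id sub_zero sub_add.
Proof. by move=> x; apply: sub_val_inj; apply: add0r. Qed.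
Fact sub_addN : left_inverse sub_zero sub_opp sub_add.
Proof. by move=> x; apply: sub_val_inj; apply: addNr. Qed.

HB.instance Definition _ :=
  GRing.isZmodule.Build U sub_addA sub_addC sub_add0 sub_addN.

Fact sub_scaleA a b x : sub_scale a (sub_scale b x) = sub_scale (a * b) x.
Proof. by apply: sub_val_inj; apply: scalerA. Qed.
Fact sub_scale1 : left_id 1 sub_scale.
Proof. by move=> x; apply: sub_val_inj; apply: scale1r. Qed.
Fact sub_scaleDr : right_distributive sub_scale +%R.
Proof. by move=> a x y; apply: sub_val_inj; apply: scalerDr. Qed.
Fact sub_scaleDl x : {morph sub_scale^~ x : a b / a + b}.
Proof. by move=> a b; apply: sub_val_inj; apply: scalerDl. Qed.

HB.instance Definition _ := GRing.Zmodule_isLmodule.Build R U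
  sub_scaleA sub_scale1 sub_scaleDr sub_scaleDl.

Fact sub_val_linear : linear sub_val. Proof. by []. Qed.
HB.instance Definition _ :=
  GRing.isLinear.Build R U V *:%R sub_val sub_val_linear.

End Submodule.

(** The element that the choice operator picks in the coset of x. It depends on
the coset only, so the quotient can be carried by the set of these elements. *)
Definition coset_repr (R : pzRingType) (V : lmodType R) (P : V -> Prop) (x : V)
  : V := choose (fun y => `[< P (x - y) >]) x.

Definition quotient_module (R : pzRingType) (V : lmodType R) (P : V -> Prop)
  & is_submodule P : Type := {x : V | x == coset_repr P x}.

Section Quotient.
Variables (R : pzRingType) (V : lmodType R) (P : V -> Prop).
Variable hP : is_submodule P.
Let Q := quotient_module hP.

HB.instance Definition _ := Choice.on Q.

Lemma coset_reprP x : P (x - coset_repr P x).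
Proof.
apply/asboolP; apply: (@chooseP _ (fun y => `[< P (x - y) >]) x).
by apply/asboolP; rewrite subrr; apply: submodule0.
Qed.

Lemma eq_coset_repr x y : P (x - y) -> coset_repr P x = coset_repr P y.
Proof.
move=> Pxy; rewrite /coset_repr.
have E : (fun z => `[< P (x - z) >]) =1 (fun z => `[< P (y - z) >]).
  move=> z; apply/asbool_equiv_eq; split=> H.
    by rewrite -(subrKA x) -opprB; apply: submoduleD => //; apply: submoduleN.
  by rewrite -(subrKA y); apply: submoduleD.
rewrite (eq_choose E); apply: choose_id; apply/asboolP; last first.
  by rewrite subrr; apply: submodule0.
by rewrite -opprB; apply: submoduleN.
Qed.

Definition quo_pi (x : V) : Q.
Proof.
exists (coset_repr P x); apply/eqP/eq_coset_repr; exact: coset_reprP.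
Defined.

Lemma quo_piP x y : quo_pi x = quo_pi y <-> P (x - y).
Proof.
split=> [/(congr1 sval) /= E|/eq_coset_repr E]; last exact: val_inj.
rewrite -(subrKA (coset_repr P x)) {2}E; apply: submoduleD => //.
  exact: coset_reprP.
by rewrite -opprB; apply: (submoduleN hP); apply: coset_reprP.
Qed.

Lemma quo_pi_sval u : quo_pi (sval u) = u.
Proof. by apply: val_inj => /=; rewrite -(eqP (svalP u)). Qed.

Definition quo_zero : Q := quo_pi 0.
Definition quo_opp (x : Q) : Q := quo_pi (- sval x).
Definition quo_add (x y : Q) : Q := quo_pi (sval x + sval y).
Definition quo_scale a (x : Q) : Q := quo_pi (a *: sval x).

Lemma quo_pi_repr x : P (sval (quo_pi x) - x).
Proof. by apply/quo_piP; rewrite quo_pi_sval. Qed.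
Lemma quo_addE x y : quo_add (quo_pi x) (quo_pi y) = quo_pi (x + y).
Proof.
apply/quo_piP; rewrite opprD addrACA.
by apply: submoduleD => //; apply: quo_pi_repr.
Qed.
Lemma quo_scaleE a x : quo_scale a (quo_pi x) = quo_pi (a *: x).
Proof.
by apply/quo_piP; rewrite -scalerBr; apply: (submoduleZ hP); apply: quo_pi_repr.
Qed.
Lemma quo_oppE x : quo_opp (quo_pi x) = quo_pi (- x).
Proof.
by apply/quo_piP; rewrite -opprD; apply: (submoduleN hP); apply: quo_pi_repr.
Qed.

Lemma quo_ind (T : Q -> Prop) : (forall x, T (quo_pi x)) -> forall u, T u.
Proof. by move=> H u; rewrite -(quo_pi_sval u). Qed.

Fact quo_addA : associative quo_add.
Proof.
elim/quo_ind=> x; elim/quo_ind=> y; elim/quo_ind=> z.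
by rewrite !quo_addE addrA.
Qed.
Fact quo_addC : commutative quo_add.
Proof. by elim/quo_ind=> x; elim/quo_ind=> y; rewrite !quo_addE addrC. Qed.
Fact quo_add0 : left_id quo_zero quo_add.
Proof. by elim/quo_ind=> x; rewrite quo_addE add0r. Qed.
Fact quo_addN : left_inverse quo_zero quo_opp quo_add.
Proof. by elim/quo_ind=> x; rewrite quo_oppE quo_addE addNr. Qed.

HB.instance Definition _ :=
  GRing.isZmodule.Build Q quo_addA quo_addC quo_add0 quo_addN.

Fact quo_scaleA a b x : quo_scale a (quo_scale b x) = quo_scale (a * b) x.
Proof. by elim/quo_ind: x => x; rewrite !quo_scaleE scalerA. Qed.
Fact quo_scale1 : left_id 1 quo_scale.
Proof. by elim/quo_ind=> x; rewrite quo_scaleE scale1r. Qed.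
Fact quo_scaleDr : right_distributive quo_scale +%R.
Proof.
move=> a; elim/quo_ind=> x; elim/quo_ind=> y.
by rewrite /GRing.add/= quo_addE !quo_scaleE quo_addE scalerDr.
Qed.
Fact quo_scaleDl x : {morph quo_scale^~ x : a b / a + b}.
Proof.
move=> a b; elim/quo_ind: x => x.
by rewrite !quo_scaleE [RHS]/GRing.add/= quo_addE scalerDl.
Qed.

HB.instance Definition _ := GRing.Zmodule_isLmodule.Build R Q
  quo_scaleA quo_scale1 quo_scaleDr quo_scaleDl.

Fact quo_pi_linear : linear quo_pi.
Proof.
by move=> a x y; rewrite -[LHS]quo_addE -[X in quo_add X _]quo_scaleE.
Qed.
HB.instance Definition _ :=
  GRing.isLinear.Build R V Q *:%R quo_pi quo_pi_linear.

Lemma quo_pi_surj : surjective quo_pi.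
Proof. by move=> u; exists (sval u); apply: quo_pi_sval. Qed.
Lemma quo_pi_eq0 x : quo_pi x = 0 <-> P x.
Proof. by rewrite -[X in _ = X]/(quo_pi 0) quo_piP subr0. Qed.

End Quotient.

Lemma ker_submodule (R : pzRingType) (U V : lmodType R) (f : {linear U -> V}) :
  is_submodule (fun x => f x = 0).
Proof.
by split=> [|a x y fx fy]; rewrite ?linear0 // linearP fx fy scaler0 addr0.
Qed.

Lemma img_submodule (R : pzRingType) (U V : lmodType R) (f : {linear U -> V}) :
  is_submodule (fun y => exists x, f x = y).
Proof.
split=> [|a _ _ [x <-] [y <-]]; first by exists 0; rewrite linear0.
by exists (a *: x + y); rewrite linearP.
Qed.

Definition kernel (R : pzRingType) (U V : lmodType R) (f : {linear U -> V}) :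
  lmodType R := submodule (ker_submodule f).
Definition kernel_incl (R : pzRingType) (U V : lmodType R)
  (f : {linear U -> V}) : {linear kernel f -> U} := @sub_val _ _ _ _.

Definition cokernel (R : pzRingType) (U V : lmodType R) (f : {linear U -> V}) :
  lmodType R := quotient_module (img_submodule f).
Definition cokernel_proj (R : pzRingType) (U V : lmodType R)
  (f : {linear U -> V}) : {linear V -> cokernel f} := quo_pi _.

Lemma kernel_incl_inj (R : pzRingType) (U V : lmodType R)
  (f : {linear U -> V}) : injective (kernel_incl f).
Proof. exact: sub_val_inj. Qed.

Lemma kernel_exact (R : pzRingType) (U V : lmodType R) (f : {linear U -> V}) :
  exact (kernel_incl f) f.
Proof.
move=> y; split=> [fy|[x <-]]; last first.
  exact: (@sub_valP _ _ _ (ker_submodule f) x).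
by exists (@to_sub _ _ _ (ker_submodule f) y fy).
Qed.

Lemma kernel_short_exact (R : pzRingType) (U V : lmodType R)
    (f : {linear U -> V}) : surjective f -> short_exact (kernel_incl f) f.
Proof. split=> //; [exact: (@kernel_incl_inj _ _ _ f)|exact: kernel_exact]. Qed.

Lemma cokernel_proj_surj (R : pzRingType) (U V : lmodType R)
  (f : {linear U -> V}) : surjective (cokernel_proj f).
Proof. exact: quo_pi_surj. Qed.

Lemma cokernel_exact (R : pzRingType) (U V : lmodType R) (f : {linear U -> V}) :
  exact f (cokernel_proj f).
Proof. by move=> y; apply: (quo_pi_eq0 (img_submodule f)). Qed.

Lemma cokernel_short_exact (R : pzRingType) (U V : lmodType R)
    (f : {linear U -> V}) : injective f -> short_exact f (cokernel_proj f).
Proof.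
split=> //; [exact: cokernel_exact|exact: (@cokernel_proj_surj _ _ _ f)].
Qed.

Lemma linear_inj0 (R : pzRingType) (U V : lmodType R) (f : {linear U -> V}) :
  (forall x, f x = 0 -> x = 0) -> injective f.
Proof.
move=> H x y fxy; apply/eqP; rewrite -subr_eq0; apply/eqP/H.
by rewrite linearB fxy subrr.
Qed.

Lemma linear_injE (R : pzRingType) (U V : lmodType R) (f : {linear U -> V}) x :
  injective f -> f x = 0 -> x = 0.
Proof. by move=> inj_f fx; apply: inj_f; rewrite linear0. Qed.

Lemma factor_surj (R : pzRingType) (A B C : lmodType R) (q : {linear A -> B})
    (f : {linear A -> C}) : surjective q -> (forall x, q x = 0 -> f x = 0) ->
  exists g : {linear B -> C}, forall x, g (q x) = f x.
Proof.
move=> /choice[s sK] qf.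
have fsq x : f (s (q x)) = f x.
  by apply/eqP; rewrite -subr_eq0 -linearB qf // linearB sK subrr.
have lin_g : linear (f \o s).
  move=> a x y /=; rewrite -linearP -[in LHS](sK x) -[in LHS](sK y) -linearP.
  exact: fsq.
by exists (linear_map lin_g) => x; apply: fsq.
Qed.

Lemma factor_inj (R : pzRingType) (K B C : lmodType R) (j : {linear K -> B})
    (f : {linear C -> B}) : injective j -> (forall x, exists k, j k = f x) ->
  exists g : {linear C -> K}, forall x, j (g x) = f x.
Proof.
move=> inj_j /choice[g gK].
have lin_g : linear g.
  by move=> a x y; apply: inj_j; rewrite linearP !gK linearP.
by exists (linear_map lin_g) => x; apply: gK.
Qed.

Definition image (R : pzRingType) (U V : lmodType R) (f : {linear U -> V}) :
  lmodType R := submodule (img_submodule f).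
Definition image_incl (R : pzRingType) (U V : lmodType R)
  (f : {linear U -> V}) : {linear image f -> V} := @sub_val _ _ _ _.

Lemma image_incl_inj (R : pzRingType) (U V : lmodType R)
  (f : {linear U -> V}) : injective (image_incl f).
Proof. exact: sub_val_inj. Qed.

Lemma image_proj (R : pzRingType) (U V : lmodType R) (f : {linear U -> V}) :
  exists2 q : {linear U -> image f}, surjective q
    & forall x, image_incl f (q x) = f x.
Proof.
have img x : exists k, image_incl f k = f x.
  by exists (@to_sub _ _ _ (img_submodule f) (f x) (ex_intro _ x erefl)).
have [q qE] := factor_inj (@image_incl_inj _ _ _ f) img.
exists q => // y; have [x xE] := @sub_valP _ _ _ (img_submodule f) y.
by exists x; apply: (@image_incl_inj _ _ _ f); rewrite qE.
Qed.

(** * Families of elements and matrices *)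

Section Combinations.
Variables (R : pzRingType) (M : lmodType R).

Definition comb_fun b (x : 'I_b -> M) (r : 'rV[R]_b) : M :=
  \sum_j r 0 j *: x j.
Fact comb_linear b (x : 'I_b -> M) : linear (comb_fun x).
Proof.
move=> a r s; rewrite /comb_fun scaler_sumr -big_split /=.
by apply: eq_bigr => j _; rewrite !mxE scalerDl scalerA.
Qed.
Definition comb b (x : 'I_b -> M) : {linear 'rV[R]_b -> M} :=
  linear_map (comb_linear x).

Lemma comb_foldE b (x : 'I_b -> M) r : comb_fun x r = comb x r.
Proof. by []. Qed.

Lemma combE b (x : 'I_b -> M) r : comb x r = \sum_j r 0 j *: x j.
Proof. by []. Qed.

Definition act a b (D : 'M[R]_(a, b)) (x : 'I_b -> M) (i : 'I_a) : M :=
  \sum_j D i j *: x j.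

Lemma actE a b (D : 'M[R]_(a, b)) x i : act D x i = comb x (row i D).
Proof. by rewrite combE; apply: eq_bigr => j _; rewrite mxE. Qed.

Lemma comb_delta b (x : 'I_b -> M) j : comb x (delta_mx 0 j) = x j.
Proof.
rewrite combE (bigD1 j) //= big1 => [|i ij].
  by rewrite mxE !eqxx scale1r addr0.
rewrite mxE eqxx.
by rewrite (negPf ij) scale0r.
Qed.

Lemma comb_basis b (f : {linear 'rV[R]_b -> M}) :
  comb (fun j => f (delta_mx 0 j)) =1 f.
Proof.
move=> r; rewrite combE [in RHS](row_sum_delta r) linear_sum.
by apply: eq_bigr => j _; rewrite linearZ.
Qed.

Lemma eq_comb b (x y : 'I_b -> M) : x =1 y -> comb x =1 comb y.
Proof. by move=> xy r; rewrite !combE; apply: eq_bigr => j _; rewrite xy. Qed.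

Lemma eq_act a b (D : 'M[R]_(a, b)) (x y : 'I_b -> M) :
  x =1 y -> act D x =1 act D y.
Proof. by move=> xy i; rewrite !actE (eq_comb xy). Qed.

Lemma comb_act a b (D : 'M[R]_(a, b)) x r : comb (act D x) r = comb x (r *m D).
Proof.
rewrite !combE; under eq_bigr do rewrite scaler_sumr.
rewrite exchange_big; apply: eq_bigr => j _ /=; rewrite mxE scaler_suml.
by apply: eq_bigr => i _; rewrite scalerA.
Qed.

Lemma act_mul a b c (E : 'M[R]_(a, b)) (D : 'M[R]_(b, c)) x :
  act (E *m D) x =1 act E (act D x).
Proof. by move=> i; rewrite !actE comb_act row_mul. Qed.

Lemma act0mx a b x i : act (0 : 'M[R]_(a, b)) x i = 0.
Proof. by rewrite /act big1 // => j _; rewrite mxE scale0r. Qed.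

Lemma actD a b (D : 'M[R]_(a, b)) x y i :
  act D (fun j => x j + y j) i = act D x i + act D y i.
Proof. by rewrite -big_split; apply: eq_bigr => j _; rewrite scalerDr. Qed.

Lemma actB a b (D : 'M[R]_(a, b)) x y i :
  act D (fun j => x j - y j) i = act D x i - act D y i.
Proof. by rewrite -sumrB; apply: eq_bigr => j _; rewrite scalerBr. Qed.

End Combinations.

Lemma map_comb (R : pzRingType) (M N : lmodType R) (f : {linear M -> N}) b
  (x : 'I_b -> M) r : f (comb x r) = comb (fun j => f (x j)) r.
Proof.
by rewrite !combE linear_sum; apply: eq_bigr => j _; rewrite linearZ.
Qed.

Lemma map_act (R : pzRingType) (M N : lmodType R) (f : {linear M -> N}) a b
  (D : 'M[R]_(a, b)) (x : 'I_b -> M) i :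
  f (act D x i) = act D (fun j => f (x j)) i.
Proof. by rewrite !actE map_comb. Qed.

Definition mx_linear (R : pzRingType) a b (D : 'M[R]_(a, b)) :
  {linear 'rV[R]_a -> 'rV[R]_b} := mulmxr D.

Lemma mx_linearE (R : pzRingType) a b (D : 'M[R]_(a, b)) r :
  mx_linear D r = r *m D.
Proof. by []. Qed.

(** Exactness of M^c -> M^b -> M^a, for the maps given by D and E. *)
Definition act_exact (R : pzRingType) (M : lmodType R) a b c (E : 'M[R]_(a, b))
  (D : 'M[R]_(b, c)) : Prop :=
  forall x : 'I_b -> M, (forall i, act E x i = 0) ->
  exists y : 'I_c -> M, x =1 act D y.

(** Exactness of R^a -> R^b -> R^c on row vectors, that is, for maps of left
modules. *)
Definition row_kernel (R : pzRingType) a b c (E : 'M[R]_(a, b))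
  (D : 'M[R]_(b, c)) : Prop :=
  forall r : 'rV[R]_b, r *m D = 0 <-> exists s, r = s *m E.

(** Exactness of R^c -> R^b -> R^a on column vectors, that is, for maps of right
modules. *)
Definition col_kernel (R : pzRingType) a b c (E : 'M[R]_(a, b))
  (D : 'M[R]_(b, c)) : Prop :=
  forall r : 'cV[R]_b, E *m r = 0 <-> exists s, r = D *m s.

Lemma row_kernel_mul0 (R : pzRingType) a b c (E : 'M[R]_(a, b))
  (D : 'M[R]_(b, c)) : row_kernel E D -> E *m D = 0.
Proof.
move=> ker_ED; apply/row_matrixP => i; rewrite row0 row_mul.
by apply/ker_ED; exists (delta_mx 0 i); rewrite -rowE.
Qed.

Lemma projective_row (R : pzRingType) n : projective ('rV[R]_n : lmodType R).
Proof.
move=> A B p f surj_p.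
have [s sK] := choice (fun j => surj_p (f (delta_mx 0 j))).
exists (comb s) => r /=; rewrite map_comb -[RHS]comb_basis.
exact: (eq_comb sK).
Qed.

(** * Coherent rings *)

(** Schanuel's argument: p is compared with the presentation R^m -> R^n -> I
through maps u : R^a -> R^n and v : R^n -> R^a over I. Relations for p are the
images under v of the given ones, and the rows of 1 - u v. *)
Lemma finitely_presented_relations (R : pzRingType) (I : lmodType R) a
    (p : {linear 'rV[R]_a -> I}) : finitely_presented I -> surjective p ->
  exists c (E : 'M[R]_(c, a)), forall r, p r = 0 <-> exists s, r = s *m E.
Proof.
move=> [m [n [f [q [ex_fq surj_q]]]]] surj_p.
have [u uE] := projective_row p surj_q; have [v vE] := projective_row q surj_p.
pose E := col_mx (lin1_mx (v \o f)) (1%:M - lin1_mx (v \o u)).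
exists _, E => r; split=> [pr|[s ->]].
  have /ex_fq[w wE] : q (u r) = 0 by rewrite -[LHS]/((q \o u) r) uE.
  exists (row_mx w r); rewrite mul_row_col mul_rV_lin1 mulmxBr mulmx1.
  by rewrite mul_rV_lin1 /= wE addrC subrK.
rewrite -[s]hsubmxK mul_row_col mul_rV_lin1 mulmxBr mulmx1 mul_rV_lin1 /=.
rewrite !linearD linearN /= -[p (v _)]/((p \o v) _) vE.
rewrite -[p (v (u _))]/((p \o v) _) vE -[q (u _)]/((q \o u) _) uE subrr addr0.
by apply/ex_fq; exists (lsubmx s).
Qed.

Lemma coherent_ideal (R : pzRingType) (hR : left_coherent R) a
  (D : 'M[R]_(a, 1)) : exists c (E : 'M[R]_(c, a)), row_kernel E D.
Proof.
have [q surj_q qE] := image_proj (mx_linear D).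
have lin_j : linear (fun r : 'rV[R]_1 => r 0 0 : R^o).
  by move=> k r s; rewrite !mxE.
pose j := linear_map lin_j.
pose i := image_incl (mx_linear D).
have inj_ji : injective (j \o i).
  move=> x y /= jxy; apply: (@image_incl_inj _ _ _ (mx_linear D)).
  by apply/rowP=> k; rewrite ord1.
have fgI : finitely_generated (image (mx_linear D)) by exists a, q.
have fpI := hR _ (j \o i) inj_ji fgI.
have [c [E hE]] := finitely_presented_relations fpI surj_q.
exists c, E => r; rewrite -hE; split=> [rD|qr].
  by apply: (@image_incl_inj _ _ _ (mx_linear D)); rewrite qE linear0.
by rewrite -mx_linearE -qE qr linear0.
Qed.

(** The system is solved one equation at a time: once the solutions of the first
equation are generated by the rows of E, the others become a system in the
coefficients of these rows, with one equation less. *)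
Lemma coherent_row_kernel (R : pzRingType) (hR : left_coherent R) a b
  (D : 'M[R]_(a, b)) : exists c (E : 'M[R]_(c, a)), row_kernel E D.
Proof.
elim: b a D => [|b IHb] a D.
  exists a, 1%:M => r; split=> [_|_]; last by rewrite thinmx0.
  by exists r; rewrite mulmx1.
rewrite -[b.+1]/(1 + b)%N in D *.
have [c [E hE]] := coherent_ideal hR (lsubmx D).
have [d [F hF]] := IHb _ (E *m rsubmx D).
exists d, (F *m E) => r; rewrite -[D]hsubmxK mul_mx_row -[0]row_mx0; split.
  move=> /eq_row_mx[/hE[s ->]]; rewrite -mulmxA => /hF[t ->].
  by exists t; rewrite mulmxA.
move=> [s ->]; congr row_mx.
  by apply/hE; exists (s *m F); rewrite mulmxA.
by rewrite mulmxA -(mulmxA (s *m F)); apply/hF; exists s.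
Qed.

(** * FP-injective dimension in terms of matrices *)

(** The left module generated by the rows of X is an (n+1)-st syzygy of a
finitely presented module, namely of the cokernel of the last matrix of the
chain. *)
Fixpoint row_syzygy (R : pzRingType) n a b (X : 'M[R]_(a, b)) : Prop :=
  if n is m.+1 then
    exists c (Y : 'M[R]_(b, c)), row_kernel X Y /\ row_syzygy m Y
  else True.

(** Vanishing of Ext^(n+1) from finitely presented modules to M. The cokernel of
X is an n-th syzygy of such a module, R^a -> R^b -> R^c is the start of a
resolution of it, and applying Hom(-, M) gives M^c -> M^b -> M^a. *)
Definition FPdim_le (R : pzRingType) n (M : lmodType R) : Prop :=
  forall a b c (Y : 'M[R]_(a, b)) (X : 'M[R]_(b, c)),
  row_syzygy n X -> row_kernel Y X -> act_exact M Y X.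

Lemma row_syzygyW (R : pzRingType) n a b (X : 'M[R]_(a, b)) :
  row_syzygy n.+1 X -> row_syzygy n X.
Proof.
elim: n a b X => // n IHn a b X [c [Y [kXY hY]]].
by exists c, Y; split=> //; apply: IHn.
Qed.

Lemma row_syzygy_leq (R : pzRingType) m n a b (X : 'M[R]_(a, b)) :
  (m <= n)%N -> row_syzygy n X -> row_syzygy m X.
Proof.
move=> /subnK <-; elim: (n - m)%N => // k IHk hX.
by apply/IHk/row_syzygyW.
Qed.

Lemma FPdim_le_leq (R : pzRingType) m n (M : lmodType R) :
  (m <= n)%N -> FPdim_le m M -> FPdim_le n M.
Proof. by move=> mn hM a b c Y X /(row_syzygy_leq mn); apply: hM. Qed.

Section ShortExact.
Variables (R : pzRingType) (K F M : lmodType R).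
Variables (i : {linear K -> F}) (p : {linear F -> M}).
Hypothesis ses : short_exact i p.

Let inj_i : injective i. Proof. by case: ses. Qed.
Let ex_ip : exact i p. Proof. by case: ses. Qed.
Let surj_p : surjective p. Proof. by case: ses. Qed.

Lemma lift_family b (x : 'I_b -> F) : (forall j, p (x j) = 0) ->
  exists y : 'I_b -> K, forall j, i (y j) = x j.
Proof.
move=> px; have H j : exists k, i k = x j by apply/ex_ip.
by have [y yE] := choice H; exists y.
Qed.

Lemma section_family b (x : 'I_b -> M) :
  exists y : 'I_b -> F, forall j, p (y j) = x j.
Proof. by have [y yE] := choice (fun j => surj_p (x j)); exists y. Qed.

Let pi x : p (i x) = 0. Proof. by apply/ex_ip; exists x. Qed.

Variables (a b c d : nat) (E : 'M[R]_(a, b)) (D : 'M[R]_(b, c)).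
Variable (C : 'M[R]_(c, d)).

(** Here and in the next two lemmas: a piece of a long exact cohomology
sequence, read off by lifting families of elements. *)
Lemma act_exact_ext : E *m D = 0 ->
  act_exact K E D -> act_exact M E D -> act_exact F E D.
Proof.
move=> ED exK exM x Ex.
have [|y yE] := exM (fun j => p (x j)).
  by move=> k; rewrite -map_act Ex linear0.
have [z zE] := section_family y.
have [|k kE] := @lift_family _ (fun j => x j - act D z j).
  by move=> j; rewrite linearB map_act yE (eq_act _ zE) subrr.
have [|l lE] := exK k.
  move=> j; apply: inj_i; rewrite map_act (eq_act _ kE) actB Ex -act_mul ED.
  by rewrite act0mx subrr linear0.
exists (fun j => i (l j) + z j) => j; rewrite actD -map_act -lE kE.
by rewrite subrK.
Qed.

Lemma act_exact_quotient : E *m D = 0 ->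
  act_exact F D C -> act_exact K E D -> act_exact M D C.
Proof.
move=> ED exF exK x Dx; have [z zE] := section_family x.
have [|k kE] := @lift_family _ (act D z).
  by move=> j; rewrite map_act (eq_act _ zE).
have [|l lE] := exK k.
  move=> j; apply: inj_i; rewrite map_act (eq_act _ kE) -act_mul ED.
  by rewrite act0mx linear0.
have [|w wE] := exF (fun j => z j - i (l j)).
  by move=> j; rewrite actB -map_act -lE kE subrr.
exists (fun j => p (w j)) => j; rewrite -map_act -wE linearB zE pi.
by rewrite subr0.
Qed.

Lemma act_exact_sub : D *m C = 0 ->
  act_exact F E D -> act_exact M D C -> act_exact K E D.
Proof.
move=> DC exF exM x Ex.
have [|z zE] := exF (fun j => i (x j)).
  by move=> j; rewrite -map_act Ex linear0.
have [|w wE] := exM (fun j => p (z j)).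
  by move=> j; rewrite -map_act -zE pi.
have [v vE] := section_family w.
have [|k kE] := @lift_family _ (fun j => z j - act C v j).
  by move=> j; rewrite linearB map_act wE (eq_act _ vE) subrr.
exists k => j; apply: inj_i; rewrite map_act (eq_act _ kE) actB -zE -act_mul DC.
by rewrite act0mx subr0.
Qed.

End ShortExact.

Section FPdimShortExact.
Variables (R : pzRingType) (K F M : lmodType R).
Variables (i : {linear K -> F}) (p : {linear F -> M}).
Hypothesis ses : short_exact i p.

Lemma FPdim_le_ext n : FPdim_le n K -> FPdim_le n M -> FPdim_le n F.
Proof.
move=> hK hM a b c Y X hX kYX; apply: (act_exact_ext ses).
- exact: row_kernel_mul0.
- exact: hK.
- exact: hM.
Qed.

Lemma FPdim_le_quotient n : left_coherent R ->
  FPdim_le n F -> FPdim_le n.+1 K -> FPdim_le n M.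
Proof.
move=> cohR hF hK a b c Y X hX kYX.
have [d [Z kZY]] := coherent_row_kernel cohR Y.
apply: (act_exact_quotient ses (row_kernel_mul0 kZY)); first exact: hF.
by apply: hK => //; exists c, X.
Qed.

Lemma FPdim_le_sub n : FPdim_le n.+1 F -> FPdim_le n M -> FPdim_le n.+1 K.
Proof.
move=> hF hM a b c Y X hX kYX; have [d [Z [kXZ hZ]]] := hX.
apply: (act_exact_sub ses (row_kernel_mul0 kXZ)); first exact: hF.
exact: hM.
Qed.

End FPdimShortExact.

(** * Vanishing of Ext *)

Lemma exact_comp0 (A B C : zmodType) (f : A -> B) (g : B -> C) x :
  exact f g -> g (f x) = 0.
Proof. by move=> ex_fg; apply/ex_fg; exists x. Qed.

Section ResolutionCons.
Variables (R : pzRingType) (K F M : lmodType R).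
Variables (i : {linear K -> F}) (p : {linear F -> M}).
Hypothesis ses : short_exact i p.
Variable P : left_resolution K.

Definition cons_res (n : nat) : lmodType R := if n is m.+1 then P m else F.
Definition cons_diff (n : nat) : {linear cons_res n.+1 -> cons_res n} :=
  if n is m.+1 then ldiff P m else (i \o laug P).

Lemma cons_surj : surjective p. Proof. by case: ses. Qed.
Lemma cons_exact0 : exact (cons_diff 0) p.
Proof.
case: ses => inj_i ex_ip _ y; split=> [/ex_ip[k <-]|[x <-]].
  by have [x <-] := laug_surj P k; exists x.
exact: (exact_comp0 _ ex_ip).
Qed.
Lemma cons_exact n : exact (cons_diff n.+1) (cons_diff n).
Proof.
case: n => [|n] /=; last exact: ldiff_exact.
case: ses => inj_i _ _ y /=; rewrite -laug_exact.
split=> [|->]; first exact: linear_injE.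
by rewrite linear0.
Qed.

Definition resolution_cons : left_resolution M :=
  @LeftResolution R M cons_res cons_diff p cons_surj cons_exact0 cons_exact.

End ResolutionCons.

Section ResolutionTail.
Variables (R : pzRingType) (M : lmodType R) (P : left_resolution M).

Lemma tail_aug_exists : exists q : {linear P 1%N -> kernel (laug P)},
  forall x, kernel_incl (laug P) (q x) = ldiff P 0 x.
Proof.
apply: factor_inj; first exact: (@kernel_incl_inj _ _ _ (laug P)).
move=> x; apply/kernel_exact; exact: (exact_comp0 _ (@laug_exact _ _ P)).
Qed.

Definition tail_aug := sval (cid tail_aug_exists).
Lemma tail_augE x : kernel_incl (laug P) (tail_aug x) = ldiff P 0 x.
Proof. exact: svalP (cid tail_aug_exists) x. Qed.

Lemma tail_surj : surjective tail_aug.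
Proof.
move=> k; have [x xE] : exists x, ldiff P 0 x = kernel_incl (laug P) k.
  by apply/laug_exact/kernel_exact; exists k.
by exists x; apply: (@kernel_incl_inj _ _ _ (laug P)); rewrite tail_augE.
Qed.

Lemma tail_exact : exact (ldiff P 1) tail_aug.
Proof.
move=> y; rewrite -ldiff_exact -tail_augE.
split=> [->|]; first by rewrite linear0.
exact: linear_injE (@kernel_incl_inj _ _ _ (laug P)).
Qed.

Definition resolution_tail : left_resolution (kernel (laug P)) :=
  @LeftResolution R _ (fun n => P n.+1) (fun n => ldiff P n.+1) tail_aug
    tail_surj tail_exact (fun n => @ldiff_exact _ _ P n.+1).
End ResolutionTail.

(** * Free modules *)

Definition finitely_supported (R : pzRingType) (X : choiceType)
  (f : X -> R^o) : Prop := exists s : seq X, forall x, x \notin s -> f x = 0.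

Lemma finitely_supported_submodule (R : pzRingType) (X : choiceType) :
  @is_submodule R (X -> R^o) (@finitely_supported R X).
Proof.
split=> [|a f g [s sE] [t tE]]; first by exists [::].
exists (s ++ t) => x; rewrite mem_cat negb_or => /andP[/sE fx /tE gx].
have -> : (a *: f + g) x = a * f x + g x by [].
by rewrite fx gx mulr0 addr0.
Qed.

Definition free_module (R : pzRingType) (X : choiceType) : lmodType R :=
  submodule (finitely_supported_submodule R X).

Section FreeModule.
Variables (R : pzRingType) (X : choiceType).
Local Notation F := (free_module R X).

Definition coef (f : F) (x : X) : R :=
  @sub_val _ _ _ (finitely_supported_submodule R X) f x.

Lemma coefP a (f g : F) x : coef (a *: f + g) x = a * coef f x + coef g x.
Proof. by []. Qed.
Lemma coef_inj f g : coef f =1 coef g -> f = g.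
Proof.
move=> fg; apply: (@sub_val_inj _ _ _ (finitely_supported_submodule R X)).
exact: funext.
Qed.

Definition support (f : F) : seq X :=
  undup (sval (cid (@sub_valP _ _ _ (finitely_supported_submodule R X) f))).
Lemma support_uniq f : uniq (support f). Proof. exact: undup_uniq. Qed.
Lemma notin_support f x : x \notin support f -> coef f x = 0.
Proof.
rewrite mem_undup => xf.
exact: (svalP (cid (@sub_valP _ _ _
  (finitely_supported_submodule R X) f)) _ xf).
Qed.

Fact basis_subproof (x : X) :
  finitely_supported (fun y => if y == x then 1 else 0 : R^o).
Proof. by exists [:: x] => y; rewrite inE => /negPf ->. Qed.
Definition basis (x : X) : F :=
  @to_sub _ _ _ (finitely_supported_submodule R X) _ (basis_subproof x).
Lemma coef_basis x y : coef (basis x) y = if y == x then 1 else 0.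
Proof. by []. Qed.

Section Sum.
Variables (V : lmodType R) (v : X -> V).
Definition free_sum_fun (f : F) : V := \sum_(x <- support f) coef f x *: v x.

Lemma free_sumE (s : seq X) f : uniq s ->
    (forall x, x \notin s -> coef f x = 0) ->
  free_sum_fun f = \sum_(x <- s) coef f x *: v x.
Proof.
have filt (t : seq X) : \sum_(x <- t) coef f x *: v x =
    \sum_(x <- [seq x <- t | coef f x != 0]) coef f x *: v x.
  rewrite big_filter [RHS]big_mkcond; apply: eq_bigr => x _.
  by case: eqP => // ->; rewrite scale0r.
move=> uniq_s sf; rewrite /free_sum_fun filt [RHS]filt.
apply: perm_big; apply: uniq_perm; rewrite ?filter_uniq ?support_uniq // => x.
rewrite !mem_filter; case: eqP => //= fx.
have [xf|/notin_support//] := boolP (x \in support f).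
by have [//|/sf] := boolP (x \in s).
Qed.

Fact free_sum_linear : linear free_sum_fun.
Proof.
move=> a f g; pose s := undup (support f ++ support g).
have us : uniq s := undup_uniq _.
have sfg x : x \notin s -> coef f x = 0 /\ coef g x = 0.
  rewrite mem_undup mem_cat negb_or.
  by move=> /andP[/notin_support ? /notin_support ?].
rewrite !(@free_sumE s) // => [|x /sfg[]//|x /sfg[]//|x /sfg[fx gx]];
  last first.
  by rewrite coefP fx gx mulr0 addr0.
rewrite scaler_sumr -big_split; apply: eq_bigr => x _.
by rewrite coefP scalerDl scalerA.
Qed.
Definition free_sum : {linear F -> V} := linear_map free_sum_linear.

Lemma free_sum_basis x : free_sum (basis x) = v x.
Proof.
rewrite [LHS](@free_sumE [:: x]) ?big_seq1 ?coef_basis ?eqxx ?scale1r // => y.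
by rewrite inE => /negPf; rewrite coef_basis => ->.
Qed.
End Sum.

Lemma free_decomposition (s : seq X) f : uniq s ->
    (forall x, x \notin s -> coef f x = 0) ->
  f = \sum_(x <- s) coef f x *: basis x.
Proof.
move=> us sf; apply: coef_inj => y.
have lin_cy : linear (fun g : F => coef g y : R^o).
  by move=> a g h; apply: coefP.
pose cy := linear_map lin_cy.
have cyE x : cy (basis x) = if y == x then 1 else 0 by [].
rewrite -[RHS]/(cy _) linear_sum; under eq_bigr do rewrite linearZ cyE.
have [ys|ys] := boolP (y \in s); last first.
  rewrite sf // big_seq big1 // => x xs; case: eqP => [E|_]; last exact: mulr0.
  by rewrite E xs in ys.
rewrite (bigD1_seq y) //= eqxx big1 ?addr0 => [|x]; first by rewrite [RHS]mulr1.
by rewrite eq_sym => /negPf ->; apply: mulr0.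
Qed.

Lemma free_sum_unique (V : lmodType R) (g : {linear F -> V}) :
  g =1 free_sum (fun x => g (basis x)).
Proof.
move=> f; rewrite {1}(free_decomposition (support_uniq f) (@notin_support f)).
by rewrite linear_sum; apply: eq_bigr => x _; rewrite linearZ.
Qed.

Lemma free_linear_ext (V : lmodType R) (f g : {linear F -> V}) :
  (forall x, f (basis x) = g (basis x)) -> f =1 g.
Proof.
move=> fg h; rewrite (free_sum_unique f) (free_sum_unique g).
by congr (free_sum _ h); apply/funext.
Qed.

Lemma projective_free : projective F.
Proof.
move=> A B p f surj_p; have [s sK] := choice (fun x => surj_p (f (basis x))).
exists (free_sum s); apply: (@free_linear_ext _ (p \o free_sum s)) => x.
by rewrite -sK; congr (p _); apply: free_sum_basis.
Qed.

End FreeModule.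

Definition free_cover (R : pzRingType) (M : lmodType R) :
  {linear free_module R M -> M} := free_sum (fun x : M => x).

Lemma free_cover_surj (R : pzRingType) (M : lmodType R) :
  surjective (free_cover M).
Proof. by move=> x; exists (basis R x); apply: free_sum_basis. Qed.

Section FreeResolution.
Variables (R : pzRingType) (M : lmodType R).

Definition free_syzygy (n : nat) : lmodType R :=
  iter n (fun K => kernel (free_cover K)) M.
Definition free_res n : lmodType R := free_module R (free_syzygy n).
Definition free_diff n : {linear free_res n.+1 -> free_res n} :=
  kernel_incl (free_cover (free_syzygy n)) \o free_cover (free_syzygy n.+1).

Lemma free_exact0 : exact (free_diff 0) (free_cover M).
Proof.
move=> y; rewrite (kernel_exact (free_cover M)); split=> [[k <-]|[x <-]].
  by have [x <-] := free_cover_surj k; exists x.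
by exists (free_cover (free_syzygy 1) x).
Qed.
Lemma free_exact n : exact (free_diff n.+1) (free_diff n).
Proof.
move=> y; split=> [|[x <-]].
  move=> /(linear_injE (@kernel_incl_inj _ _ _ _)).
  move=> /(kernel_exact (free_cover (free_syzygy n.+1)))[k <-].
  by have [x <-] := free_cover_surj k; exists x.
have fd0 : free_cover (free_syzygy n.+1) (free_diff n.+1 x) = 0.
  by apply/(kernel_exact (free_cover (free_syzygy n.+1))); eexists.
by rewrite -[LHS]/(kernel_incl _ (free_cover _ (free_diff n.+1 x))) fd0 linear0.
Qed.
Definition free_resolution : left_resolution M :=
  @LeftResolution R M free_res free_diff (free_cover M)
    (@free_cover_surj R M) free_exact0 free_exact.

Lemma free_resolution_projective n : projective (free_resolution n).
Proof. exact: projective_free. Qed.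
End FreeResolution.

(** * Ext and short exact sequences *)

(** Here al and be are such that be al - 1 factors through a projective module
Q. This passes to the syzygies K and K': lifting al, be and v to maps phi, psi
and w between F, F' and Q, the map psi phi - 1 - w u p' takes its values in K',
and its restriction to K' is be1 al1 - 1, which thus factors through F'. *)
Lemma stable_syzygy (R : pzRingType) (K F A K' F' A' Q : lmodType R)
    (i : {linear K -> F}) (p : {linear F -> A})
    (i' : {linear K' -> F'}) (p' : {linear F' -> A'})
    (al : {linear A' -> A}) (be : {linear A -> A'})
    (u : {linear A' -> Q}) (v : {linear Q -> A'}) :
    short_exact i p -> short_exact i' p' ->
    projective F -> projective F' -> projective Q ->
    (forall x, be (al x) = x + v (u x)) ->
  exists (phi : {linear F' -> F}) (al1 : {linear K' -> K})
    (be1 : {linear K -> K'}) (h : {linear F' -> K'}),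
  (forall k, i (al1 k) = phi (i' k)) /\
  (forall k, be1 (al1 k) = k + h (i' k)).
Proof.
move=> [inj_i ex_ip surj_p] [inj_i' ex_ip' surj_p'] projF projF' projQ beal.
have [phi phiE] := projF' _ _ p (al \o p') surj_p.
have [psi psiE] := projF _ _ p' (be \o p) surj_p'.
have [w wE] := projQ _ _ p' v surj_p'.
have [|al1 al1E] := factor_inj (f := phi \o i') inj_i.
  move=> k; apply/ex_ip; rewrite -[LHS]/((p \o phi) (i' k)) phiE /=.
  by rewrite (exact_comp0 _ ex_ip') linear0.
have [|be1 be1E] := factor_inj (f := psi \o i) inj_i'.
  move=> k; apply/ex_ip'; rewrite -[LHS]/((p' \o psi) (i k)) psiE /=.
  by rewrite (exact_comp0 _ ex_ip) linear0.
pose d := ((psi \o phi) \- idfun) \- (w \o (u \o p')).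
have [|h hE] := factor_inj (f := d) inj_i'.
  move=> x; apply/ex_ip'; rewrite /= !linearB.
  rewrite -[p' (psi _)]/((p' \o psi) _) psiE /=.
  rewrite -[p' (w _)]/((p' \o w) _) wE -[p (phi _)]/((p \o phi) _) phiE /=.
  by rewrite beal addrAC addrK subrr.
exists phi, al1, be1, h; split=> // k; apply: inj_i'.
rewrite linearD hE be1E /= al1E.
have -> : p' (i' k) = 0 by apply: (exact_comp0 _ ex_ip').
by rewrite (linear0 u) (linear0 w) subr0 addrC subrK.
Qed.

(** Two presentations of the same module A: the case al = be = 1 above. *)
Lemma schanuel (R : pzRingType) (K F K' F' A : lmodType R)
    (i : {linear K -> F}) (p : {linear F -> A})
    (i' : {linear K' -> F'}) (p' : {linear F' -> A}) :
    short_exact i p -> short_exact i' p' -> projective F -> projective F' ->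
  exists (phi : {linear F' -> F}) (al : {linear K' -> K})
    (be : {linear K -> K'}) (h : {linear F' -> K'}),
  (forall k, i (al k) = phi (i' k)) /\
  (forall k, be (al k) = k + h (i' k)).
Proof.
move=> ses ses' projF projF'.
apply: (stable_syzygy (al := idfun) (be := idfun) ses ses' projF projF'
  (@projective_row R 0) (u := \0) (v := \0)).
by move=> x; apply: esym (addr0 x).
Qed.

Section ExtShortExact.
Variables (R : pzRingType) (N : lmodType R).

Lemma Ext1_extend (K F A : lmodType R) (i : {linear K -> F})
    (p : {linear F -> A}) : short_exact i p -> projective F ->
  Ext1_vanishes A N ->
  forall f : {linear K -> N}, exists g : {linear F -> N}, g \o i =1 f.
Proof.
move=> ses projF ExtA f.
have proj_res n : projective (resolution_cons ses (free_resolution K) n).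
  by case: n => // n; apply: free_resolution_projective.
have [|g gE] := ExtA _ proj_res (f \o free_cover K).
  move=> x; rewrite -[RHS](linear0 f); congr (f _).
  exact: (exact_comp0 _ (@free_exact0 R K)).
by exists g => k; have [x <-] := free_cover_surj k;
  rewrite -[RHS]/((f \o _) x) gE.
Qed.

Lemma ExtS_shift n (K F A : lmodType R) (i : {linear K -> F})
    (p : {linear F -> A}) : short_exact i p -> projective F ->
  ExtS_vanishes n.+1 A N -> ExtS_vanishes n K N.
Proof.
move=> ses projF ExtA P projP f fd.
have proj_res m : projective (resolution_cons ses P m) by case: m.
exact: ExtA proj_res f fd.
Qed.

(** A' is a retract of A up to maps factoring through a projective module; Ext
does not see such maps. This makes the vanishing of Ext, which is a statement
about all projective resolutions, a consequence of its vanishing along one. *)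
Lemma ExtS_stable n (A A' Q : lmodType R) (al : {linear A' -> A})
    (be : {linear A -> A'}) (u : {linear A' -> Q}) (v : {linear Q -> A'}) :
    projective Q -> (forall x, be (al x) = x + v (u x)) ->
  ExtS_vanishes n A N -> ExtS_vanishes n A' N.
Proof.
elim: n A A' Q al be u v => [|n IHn] A A' Q al be u v projQ beal ExtA P projP.
  move=> f fd.
  have ses := kernel_short_exact (@free_cover_surj R A).
  have ses' := kernel_short_exact (@laug_surj _ _ P).
  have [phi [al1 [be1 [h [al1E beal1]]]]] :=
    stable_syzygy ses ses' (@projective_free _ _) (projP 0%N) projQ beal.
  have [|fb fbE] := factor_surj (f := f) (@tail_surj _ _ P).
    by move=> x /tail_exact[y <-].
  have [g gE] := Ext1_extend ses (@projective_free _ _) ExtA (fb \o be1).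
  exists ((g \o phi) \- (fb \o h)) => x; rewrite -fbE /= -tail_augE.
  rewrite -al1E -[g _]/((g \o _) _) gE /= beal1 linearD.
  by rewrite addrK.
have ses := kernel_short_exact (@free_cover_surj R A).
have ses' := kernel_short_exact (@laug_surj _ _ P).
have [phi [al1 [be1 [h [al1E beal1]]]]] :=
  stable_syzygy ses ses' (@projective_free _ _) (projP 0%N) projQ beal.
have ExtK := ExtS_shift ses (@projective_free _ _) ExtA.
exact: IHn (projP 0%N) beal1 ExtK (resolution_tail P) (fun m => projP m.+1).
Qed.

Lemma ExtS_unshift n (K F A : lmodType R) (i : {linear K -> F})
    (p : {linear F -> A}) : short_exact i p -> projective F ->
  ExtS_vanishes n K N -> ExtS_vanishes n.+1 A N.
Proof.
move=> ses projF ExtK P projP f fd.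
have ses' := kernel_short_exact (@laug_surj _ _ P).
have [phi [al1 [be1 [h [al1E beal1]]]]] :=
  schanuel ses ses' projF (projP 0%N).
exact: (ExtS_stable (projP 0%N) beal1 ExtK (P := resolution_tail P)
  (fun m => projP m.+1) fd).
Qed.

Lemma Ext1_vanishes_extend (K F A : lmodType R) (i : {linear K -> F})
    (p : {linear F -> A}) : short_exact i p -> projective F ->
  (forall f : {linear K -> N}, exists g : {linear F -> N}, g \o i =1 f) ->
  Ext1_vanishes A N.
Proof.
move=> ses projF extK P projP f fd.
have ses' := kernel_short_exact (@laug_surj _ _ P).
have [phi [al1 [be1 [h [al1E beal1]]]]] :=
  schanuel ses ses' projF (projP 0%N).
have [|fb fbE] := factor_surj (f := f) (@tail_surj _ _ P).
  by move=> x /tail_exact[y <-].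
have [g gE] := extK (fb \o be1).
exists ((g \o phi) \- (fb \o h)) => x; rewrite -fbE /= -tail_augE.
rewrite -al1E -[g _]/((g \o _) _) gE /= beal1 linearD.
by rewrite addrK.
Qed.
End ExtShortExact.

(** * FP-injective dimension in terms of Ext *)

Section FPdimExt.
Variables (R : pzRingType) (N : lmodType R).

Lemma image_short_exact (A B C : lmodType R) (f : {linear A -> B})
    (q : {linear B -> C}) :
  exact f q -> surjective q -> short_exact (image_incl f) q.
Proof.
move=> ex_fq surj_q; split=> //; first exact: (@image_incl_inj _ _ _ f).
move=> y; rewrite (ex_fq y); split=> [fy|[k <-]].
  by exists (@to_sub _ _ _ (img_submodule f) y fy).
exact: (@sub_valP _ _ _ (img_submodule f) k).
Qed.

(** If the rows of X are the relations between the rows of Y, the cokernel of X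
is the row space of Y, hence a syzygy of the cokernel of Y. *)
Lemma cokernel_row_syzygy a b c (X : 'M[R]_(a, b)) (Y : 'M[R]_(b, c))
    (A : lmodType R) (q : {linear 'rV[R]_b -> A}) :
    row_kernel X Y -> exact (mx_linear X) q -> surjective q ->
  exists g : {linear A -> 'rV[R]_c},
    short_exact g (cokernel_proj (mx_linear Y)).
Proof.
move=> kXY ex_Xq surj_q.
have kq r : q r = 0 <-> r *m Y = 0.
  by rewrite (ex_Xq r) (kXY r); split=> [[s <-]|[s ->]]; exists s.
have [|g gE] := factor_surj (f := mx_linear Y) surj_q; first by move=> r /kq.
exists g; split; last exact: (@cokernel_proj_surj _ _ _ (mx_linear Y)).
  apply: linear_inj0 => x; have [r <-] := surj_q x.
  by rewrite gE => /kq.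
move=> y; rewrite (@cokernel_exact _ _ _ (mx_linear Y) y).
split=> [[r <-]|[x <-]]; first by exists (q r); rewrite gE.
by have [r <-] := surj_q x; exists r; rewrite gE.
Qed.

Lemma Ext_row_syzygy j i a b (X : 'M[R]_(a, b)) (A : lmodType R)
    (q : {linear 'rV[R]_b -> A}) :
    row_syzygy j X -> exact (mx_linear X) q -> surjective q ->
    (forall P : lmodType R, finitely_presented P ->
      ExtS_vanishes (i + j) P N) ->
  ExtS_vanishes i A N.
Proof.
elim: j i a b X A q => [|j IHj] i a b X A q.
  by move=> _ ex_Xq surj_q; rewrite addn0; apply; exists a, b, (mx_linear X), q.
move=> [c [Y [kXY hY]]] ex_Xq surj_q ExtN.
have [g ses] := cokernel_row_syzygy kXY ex_Xq surj_q.
apply: (ExtS_shift ses (@projective_row _ _)).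
apply: (IHj i.+1 _ _ Y _ (cokernel_proj (mx_linear Y))) => //.
- exact: cokernel_exact.
- exact: cokernel_proj_surj.
- by rewrite addSnnS.
Qed.

(** A family x killed by Y is a map to N from the row space of X, and a solution
y of x = X y is an extension of this map to R^c. *)
Lemma act_exact_of_extension a b c (Y : 'M[R]_(a, b)) (X : 'M[R]_(b, c)) :
    row_kernel Y X ->
    (forall f : {linear image (mx_linear X) -> N},
      exists g : {linear 'rV[R]_c -> N}, g \o image_incl (mx_linear X) =1 f) ->
  act_exact N Y X.
Proof.
move=> kYX ext x Yx; have [p surj_p pE] := image_proj (mx_linear X).
have [|f fE] := factor_surj (f := comb x) surj_p.
  move=> r pr; have /kYX[s ->] : r *m X = 0.
    by rewrite -mx_linearE -pE pr linear0.
  by rewrite -comb_act combE big1 // => k _; rewrite Yx scaler0.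
have [g gE] := ext f; exists (fun k => g (delta_mx 0 k)) => j.
rewrite actE comb_basis rowE -mx_linearE -pE -[RHS]/((g \o _) _) gE fE.
by rewrite comb_delta.
Qed.

Lemma Ext1_act_exact a b c (Y : 'M[R]_(a, b)) (X : 'M[R]_(b, c))
    (A : lmodType R) (q : {linear 'rV[R]_c -> A}) :
    row_kernel Y X -> exact (mx_linear X) q -> surjective q ->
  Ext1_vanishes A N -> act_exact N Y X.
Proof.
move=> kYX ex_Xq surj_q Ext1; apply: act_exact_of_extension kYX _ => f.
have ses := image_short_exact ex_Xq surj_q.
exact: (Ext1_extend ses (@projective_row _ _) Ext1).
Qed.

Lemma FPdim_le_Ext n :
    (forall P : lmodType R, finitely_presented P -> ExtS_vanishes n P N) ->
  FPdim_le n N.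
Proof.
move=> ExtN a b c Y X hX kYX.
have ex_Xq := @cokernel_exact _ _ _ (mx_linear X).
have surj_q := @cokernel_proj_surj _ _ _ (mx_linear X).
apply: (Ext1_act_exact kYX ex_Xq surj_q).
exact: (Ext_row_syzygy (i := 0) hX ex_Xq surj_q).
Qed.

Lemma Ext_FPdim_le n : left_coherent R -> FPdim_le n N ->
  forall P : lmodType R, finitely_presented P -> ExtS_vanishes n P N.
Proof.
move=> cohR hN P [a [b [f [q [ex_fq surj_q]]]]].
have {}ex_fq : exact (mx_linear (lin1_mx f)) q.
  move=> y; rewrite (ex_fq y).
  by split=> [[x <-]|[x <-]]; exists x; rewrite /= mul_rV_lin1.
suff main i : forall a b (P : lmodType R) (X : 'M[R]_(a, b))
    (q : {linear 'rV[R]_b -> P}), exact (mx_linear X) q -> surjective q ->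
    (i <= n)%N -> row_syzygy (n - i) X -> ExtS_vanishes i P N.
  by apply: main ex_fq surj_q _ _; rewrite ?subnn.
elim: i {a b P f q ex_fq surj_q} => [|i IHi] a b P X q ex_Xq surj_q i_n.
  rewrite subn0 => hX.
  apply: Ext1_vanishes_extend (image_short_exact ex_Xq surj_q)
    (@projective_row _ _) _ => f'.
  have [p surj_p pE] := image_proj (mx_linear X).
  have [d [Y kYX]] := coherent_row_kernel cohR X.
  have [|y yE] := hN _ _ _ Y X hX kYX (fun j => f' (p (delta_mx 0 j))).
    move=> k; rewrite actE (comb_basis (f' \o p)) /=.
    rewrite (_ : p _ = 0) ?linear0 //.
    apply: (@image_incl_inj _ _ _ (mx_linear X)).
    by rewrite pE linear0 mx_linearE -row_mul (row_kernel_mul0 kYX) row0.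
  exists (comb y) => z; have [r <-] := surj_p z.
  rewrite -[LHS]/(comb y (image_incl _ (p r))) pE mx_linearE -comb_act.
  rewrite -(eq_comb yE).
  exact: (comb_basis (f' \o p)).
move=> hX; have [d [Y kYX]] := coherent_row_kernel cohR X.
have [p surj_p pE] := image_proj (mx_linear X).
apply: (ExtS_unshift (image_short_exact ex_Xq surj_q) (@projective_row _ _)).
apply: (IHi _ _ _ Y p) => //; last 2 first.
- exact: ltnW.
- by rewrite -(subnSK i_n); exists b, X.
move=> r; split=> [pr|[s <-]].
  have /kYX[s ->] : r *m X = 0 by rewrite -mx_linearE -pE pr linear0.
  by exists s.
apply: (@image_incl_inj _ _ _ (mx_linear X)).
by rewrite pE linear0 !mx_linearE -mulmxA (row_kernel_mul0 kYX) mulmx0.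
Qed.
End FPdimExt.

(** * Passing to the opposite ring *)

Lemma mul_col (R : pzRingType) a b c (A : 'M[R]_(a, b)) (B : 'M[R]_(b, c)) k :
  A *m col k B = col k (A *m B).
Proof. by rewrite !colE mulmxA. Qed.

Lemma col_kernel_tr (R : pzRingType) a b c (E : 'M[R]_(a, b))
    (D : 'M[R]_(b, c)) :
  col_kernel E D <->
  row_kernel ((D : 'M[R^c]_(b, c))^T) ((E : 'M[R^c]_(a, b))^T).
Proof.
split=> kED r.
  rewrite -[r]trmxK -(@trmx_mul_rev R _ _ _ E r^T) -(trmx0 R^c) .
  split=> [/trmx_inj/kED[s sE]|[s sE]].
    by exists s^T; rewrite -(@trmx_mul_rev R _ _ _ D s) -sE trmxK.
  congr (trmx _); apply/kED; exists s^T; apply: trmx_inj.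
  by rewrite sE trmx_mul_rev trmxK.
split=> [Er|[s ->]].
  have /kED[s sE] : (r : 'M[R^c]__)^T *m (E : 'M[R^c]_(a, b))^T = 0.
    by rewrite -(@trmx_mul_rev R) Er trmx0.
  by exists s^T; apply: trmx_inj; rewrite sE trmx_mul_rev trmxK.
apply: trmx_inj; rewrite trmx0 [LHS](@trmx_mul_rev R); apply/kED.
by exists s^T; rewrite (@trmx_mul_rev R).
Qed.

Lemma coherent_col_kernel (R : pzRingType) (hR : left_coherent R^c) a b
  (E : 'M[R]_(a, b)) : exists c (D : 'M[R]_(b, c)), col_kernel E D.
Proof.
have [c [F kF]] := coherent_row_kernel hR ((E : 'M[R^c]_(a, b))^T).
by exists c, F^T; apply/col_kernel_tr; rewrite trmxK.
Qed.

Lemma act_exact_regular (R : pzRingType) a b c (E : 'M[R]_(a, b))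
    (D : 'M[R]_(b, c)) : E *m D = 0 ->
  act_exact (R^o : lmodType R) E D <-> col_kernel E D.
Proof.
move=> ED; split=> [exED r|kED x Ex].
  split=> [Er|[s ->]]; last by rewrite mulmxA ED mul0mx.
  have [|y yE] := exED (fun j => r j 0).
    by move=> i; have /matrixP/(_ i 0) := Er; rewrite !mxE.
  exists (\col_k y k); apply/colP => j; rewrite yE mxE; apply: eq_bigr => k _.
  by rewrite mxE.
have /kED[s sE] : E *m (\col_j x j) = 0.
  apply/colP => i; rewrite !mxE -[RHS](Ex i); apply: eq_bigr => j _.
  by rewrite mxE.
exists (fun k => s k 0) => j; have /colP/(_ j) := sE.
by rewrite !mxE.
Qed.

Lemma act_exact_regular_op (R : pzRingType) a b c (E : 'M[R]_(a, b))
    (D : 'M[R]_(b, c)) : E *m D = 0 ->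
  act_exact ((R^c)^o : lmodType R^c) ((D : 'M[R^c]_(b, c))^T)
    ((E : 'M[R^c]_(a, b))^T) <-> row_kernel E D.
Proof.
move=> ED; split=> [exED r|kED x Dx].
  split=> [rD|[s ->]]; last by rewrite -mulmxA ED mulmx0.
  have [|y yE] := exED (fun j => r 0 j).
    move=> i; have /matrixP/(_ 0 i) := rD; rewrite !mxE => <-.
    by apply: eq_bigr => j _; rewrite mxE.
  exists (\row_k y k); apply/rowP => j; rewrite yE mxE; apply: eq_bigr => k _.
  by rewrite !mxE.
have /kED[s sE] : (\row_j (x j : R)) *m D = 0.
  apply/rowP => i; rewrite !mxE -[RHS](Dx i); apply: eq_bigr => j _.
  by rewrite !mxE.
exists (fun k => s 0 k) => j; have /rowP/(_ j) := sE.
by rewrite !mxE => ->; apply: eq_bigr => k _; rewrite mxE.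
Qed.

(** * Flatness *)

(** The condition of the equational criterion for flatness: relations between
elements of M come from relations in R. *)
Definition lifts_relations (R : pzRingType) (M : lmodType R) : Prop :=
  forall a b (E : 'M[R]_(a, b)) (x : 'I_b -> M), (forall i, act E x i = 0) ->
  exists c (D : 'M[R]_(b, c)) (y : 'I_c -> M), E *m D = 0 /\ x =1 act D y.

(** An element of M^b killed by E is C y for some matrix C with E C = 0, and
such a C factors through D. *)
Lemma lifts_relations_act_exact (R : pzRingType) (M : lmodType R) a b c
    (E : 'M[R]_(a, b)) (D : 'M[R]_(b, c)) :
  lifts_relations M -> col_kernel E D -> act_exact M E D.
Proof.
move=> hM kED x /hM[d [C [y [EC xC]]]].
have H k : exists s, col k C = D *m s.
  by apply/kED; apply/colP => i; rewrite mul_col EC !mxE.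
have [s sE] := choice H; exists (act (\matrix_(i, k) s k i 0) y) => j.
rewrite xC -act_mul; apply: eq_bigr => k _; congr (_ *: _).
have /colP/(_ j) := sE k; rewrite !mxE => ->.
by apply: eq_bigr => l _; rewrite !mxE.
Qed.

Lemma lifts_relations_FPdim (R : pzRingType) (M : lmodType R) n :
  FPdim_le n (R^o : lmodType R) -> lifts_relations M -> FPdim_le n M.
Proof.
move=> hR hM a b c Y X hX kYX; apply: lifts_relations_act_exact => //.
by apply/act_exact_regular; [apply: row_kernel_mul0|apply: hR].
Qed.

(** The coordinates of the x_j on the finitely many basis elements involved are
the coefficients of the lifted relation. *)
Lemma lifts_relations_free (R : pzRingType) (X : choiceType) :
  lifts_relations (free_module R X).
Proof.
move=> a b E x Ex.
pose s := undup (flatten [seq support (x j) | j <- enum 'I_b]).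
have sE j y : y \notin s -> coef (x j) y = 0.
  move=> ys; apply: notin_support; apply: contra ys => ys.
  rewrite mem_undup; apply/flatten_mapP; exists j => //; exact: mem_enum.
exists (size s), (\matrix_(j, k) coef (x j) (tnth (in_tuple s) k)).
exists (fun k => basis R (tnth (in_tuple s) k)); split.
  apply/matrixP => i k; rewrite !mxE; pose y := tnth (in_tuple s) k.
  have lin_cy : linear (fun g : free_module R X => coef g y : R^o).
    by move=> c g h; apply: coefP.
  have /(congr1 (linear_map lin_cy)) := Ex i.
  rewrite linear0 map_act => {2}<-; apply: eq_bigr => j _.
  by rewrite mxE.
move=> j; rewrite {1}(free_decomposition (undup_uniq _) (sE j)) big_tnth.
by apply: eq_bigr => k _; rewrite mxE.
Qed.

Lemma lifts_relations_retract (R : pzRingType) (M F : lmodType R)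
    (i : {linear M -> F}) (p : {linear F -> M}) :
  p \o i =1 id -> lifts_relations F -> lifts_relations M.
Proof.
move=> pi hF a b E x Ex.
have [|c [D [y [ED yE]]]] := hF _ _ E (fun j => i (x j)).
  by move=> k; rewrite -map_act Ex linear0.
exists c, D, (fun k => p (y k)); split=> // j.
by rewrite -map_act -yE -[RHS]/((p \o i) _) pi.
Qed.

Lemma lifts_relations_projective (R : pzRingType) (P : lmodType R) :
  projective P -> lifts_relations P.
Proof.
move=> projP.
have [i iK] := projP _ _ (free_cover P) idfun (@free_cover_surj R P).
exact: lifts_relations_retract iK (@lifts_relations_free R P).
Qed.

Lemma injective_FPdim (R : pzRingType) (I : lmodType R) :
  injective_module I -> FPdim_le 0 I.
Proof.
move=> injI a b c Y X _ kYX; apply: act_exact_of_extension kYX _ => f.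
exact: (injI _ _ _ f (@image_incl_inj _ _ _ (mx_linear X))).
Qed.

(** * Syzygies *)

(** K is the n-th syzygy of M in some exact sequence 0 -> K -> F_(n-1) -> ... ->
F_0 -> M -> 0 with terms in S. *)
Fixpoint syzygy (R : pzRingType) (S : lmodType R -> Prop) n (K M : lmodType R) :
    Prop :=
  if n is m.+1 then exists (K' F : lmodType R) (i : {linear K' -> F})
    (p : {linear F -> M}), [/\ short_exact i p, S F & syzygy S m K K']
  else K = M.

Lemma syzygy_of_finite_left_dim (R : pzRingType) (S : lmodType R -> Prop)
    (M : lmodType R) : finite_left_dim S M ->
  exists n (K : lmodType R), S K /\ syzygy S n K M.
Proof.
move=> [n [P [SP P0]]]; elim: n M P SP P0 => [|n IHn] M P SP P0.
  (* P 1 is the zero module, and a first syzygy of M. *)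
  exists 1%N, (P 1%N); split=> //.
  exists (P 1%N), (P 0%N), (ldiff P 0), (laug P).
  split=> //; split; [|exact: laug_exact|exact: laug_surj].
  by move=> x y _; rewrite (P0 1%N isT x) (P0 1%N isT y).
have [||m [K [SK syzK]]] := IHn _ (resolution_tail P).
- by move=> i; apply: SP.
- by move=> i ni x; apply: (P0 i.+1).
exists m.+1, K; split=> //.
exists (kernel (laug P)), (P 0%N), (kernel_incl (laug P)), (laug P); split=> //.
exact/kernel_short_exact/laug_surj.
Qed.

Section StalkResolution.
Variables (R : pzRingType) (M : lmodType R).

Definition stalk n : lmodType R := if n is 0 then M else 'rV[R]_0.

Lemma stalk0 n (x : stalk n.+1) : x = 0.
Proof. exact: thinmx0. Qed.

Lemma stalk_surj : surjective (idfun : {linear M -> M}).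
Proof. by move=> x; exists x. Qed.
Lemma stalk_exact0 : exact (\0 : {linear stalk 1 -> stalk 0})
  (idfun : {linear M -> M}).
Proof. by move=> y; split=> [y0|[x <-]] //; exists 0; apply: esym. Qed.
Lemma stalk_exact n : exact (\0 : {linear stalk n.+2 -> stalk n.+1})
  (\0 : {linear stalk n.+1 -> stalk n}).
Proof. by move=> y; split=> // _; exists 0; rewrite (stalk0 y). Qed.

Definition stalk_resolution : left_resolution M :=
  @LeftResolution R M stalk (fun n => \0) idfun stalk_surj stalk_exact0
    stalk_exact.
End StalkResolution.

Lemma finite_left_dim_of_syzygy (R : pzRingType) (S : lmodType R -> Prop) n
    (K M : lmodType R) :
  S 'rV[R]_0 -> S K -> syzygy S n K M -> finite_left_dim S M.
Proof.
move=> S0 SK; elim: n M => [|n IHn] M /=.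
  move=> <-; exists 0%N, (stalk_resolution K); split=> [[|i]|[|i]] //= _ x.
  exact: thinmx0.
move=> [K' [F [i [p [ses SF /IHn[m [P [SP P0]]]]]]]].
exists m.+1, (resolution_cons ses P); split=> [[|j]|[|j]] //; first exact: SP.
exact: P0.
Qed.

Lemma free_syzygy_syzygy (R : pzRingType) (M : lmodType R) n :
  syzygy (@projective R) n (free_syzygy M n) M.
Proof.
suff H m : syzygy (@projective R) n (free_syzygy M (n + m)) (free_syzygy M m).
  by move: (H 0%N); rewrite addn0.
elim: n m => // n IHn m.
exists (free_syzygy M m.+1), (free_res M m), (kernel_incl (free_cover _)),
  (free_cover _); split; last by rewrite addSnnS.
- exact/kernel_short_exact/free_cover_surj.
- exact: projective_free.
Qed.

Lemma syzygyW (R : pzRingType) (S T : lmodType R -> Prop) n (K M : lmodType R) :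
  (forall F, S F -> T F) -> syzygy S n K M -> syzygy T n K M.
Proof.
move=> ST; elim: n M => //= n IHn M [K' [F [i [p [ses SF /IHn syzK]]]]].
by exists K', F, i, p; split=> //; apply: ST.
Qed.

Lemma FPdim_of_flat_syzygy (R : pzRingType) m n (K M : lmodType R) :
    left_coherent R -> FPdim_le m (R^o : lmodType R) ->
    syzygy (@lifts_relations R) n K M -> FPdim_le m K -> FPdim_le m M.
Proof.
move=> cohR hR; elim: n M => [|n IHn] M /=; first by move=> <-.
move=> [K' [F [i [p [ses flatF /IHn syzK]]]]] /syzK hK'.
apply: (FPdim_le_quotient ses cohR); first exact: lifts_relations_FPdim.
exact: FPdim_le_leq hK'.
Qed.

(** * Flat syzygies of modules of finite FP-injective dimension *)

Lemma col_kernel_mul0 (R : pzRingType) a b c (E : 'M[R]_(a, b))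
  (D : 'M[R]_(b, c)) : col_kernel E D -> E *m D = 0.
Proof.
by move=> kED; apply/matrixP => i j; have /matrixP/(_ i 0) : E *m col j D = 0;
  [apply/kED; exists (delta_mx j 0); rewrite colE|rewrite mul_col !mxE].
Qed.

Lemma row_syzygy_tr (R : pzRingType) n a b c (E : 'M[R]_(a, b))
    (D : 'M[R]_(b, c)) : col_kernel E D ->
  row_syzygy n ((E : 'M[R^c]_(a, b))^T) ->
  row_syzygy n.+1 ((D : 'M[R^c]_(b, c))^T).
Proof. by move=> /col_kernel_tr kED hE; exists a, E^T. Qed.

(** Finite FP-injective dimension of R on the right makes a column resolution
exact on rows as well, from the m-th step on. *)
Lemma row_kernel_of_col_kernel (R : pzRingType) m a b c (E : 'M[R]_(a, b))
    (D : 'M[R]_(b, c)) :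
  FPdim_le m ((R^c)^o : lmodType R^c) ->
  row_syzygy m ((E : 'M[R^c]_(a, b))^T) -> col_kernel E D -> row_kernel E D.
Proof.
move=> hRop hE kED; apply/act_exact_regular_op; first exact: col_kernel_mul0.
by apply: hRop => //; apply/col_kernel_tr.
Qed.

(** Sizes are bundled with the matrix so that a resolution is the sequence of
iterates of a function, whose consecutive terms have definitionally matching
sizes. *)
Record some_mx (R : pzRingType) :=
  SomeMx { nrow : nat; ncol : nat; the_mx :> 'M[R]_(nrow, ncol) }.

Section ColStep.
Variables (R : pzRingType) (cohRop : left_coherent R^c).

Definition col_step (X : some_mx R) : some_mx R :=
  SomeMx (sval (cid (svalP (cid (coherent_col_kernel cohRop X))))).

Lemma col_stepP (X : some_mx R) : col_kernel X (col_step X).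
Proof. exact: svalP (cid (svalP (cid (coherent_col_kernel cohRop X)))). Qed.

Lemma flat_syzygy_act_exact (X : some_mx R) n (K M : lmodType R) j :
  syzygy (@lifts_relations R) n K M ->
  act_exact M (iter (n + j) col_step X) (iter (n + j).+1 col_step X) ->
  act_exact K (iter j col_step X) (iter j.+1 col_step X).
Proof.
elim: n M => [|n IHn] M; first by move=> <-.
move=> [K' [F [i [p [ses flatF /IHn syzK]]]]] exM; apply: syzK.
have k0 := @col_stepP (iter (n + j) col_step X).
have k1 := col_kernel_mul0 (@col_stepP (iter (n + j).+1 col_step X)).
exact: (act_exact_sub ses k1 (lifts_relations_act_exact flatF k0) exM).
Qed.

(** Let X_0 = E, X_1, X_2, ... be a resolution by columns of the right module
presented by E. From X_m on it is exact on rows too, and read backwards it is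
the start of a resolution of left modules presented by the X_k for k large; so
exactness of M along X_m, X_(m+1) is the vanishing of an Ext^(n+1) to M.
Shifting down along K gives exactness of K along E, X_1: relations lift. *)
Lemma flat_syzygy_of_FPdim m n (K M : lmodType R) :
    FPdim_le m ((R^c)^o : lmodType R^c) -> FPdim_le n M ->
  syzygy (@lifts_relations R) m K M -> lifts_relations K.
Proof.
move=> hRop hM syzK a b E x Ex; pose X j := iter j col_step (SomeMx E).
have kX j : col_kernel (X j) (X j.+1) by apply: col_stepP.
have rX j : row_syzygy j ((X j : 'M[R^c]_(_, _))^T).
  by elim: j => [|j IHj]; [|apply: row_syzygy_tr IHj].
have rkX j : (m <= j)%N -> row_kernel (X j) (X j.+1).
  by move=> /row_syzygy_leq/(_ (rX j))/row_kernel_of_col_kernel; apply.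
have rsX k : forall j, (m <= j)%N -> row_syzygy k (X j).
  elim: k => // k IHk j mj; exists _, (X j.+1); split; first exact: rkX.
  exact: (IHk j.+1 (leqW mj)).
have exM : act_exact M (X m) (X m.+1).
  exact: (hM _ _ _ _ _ (rsX n m.+1 (leqnSn m)) (rkX m (leqnn m))).
have exK : act_exact K (X 0%N) (X 1%N).
  by apply: (@flat_syzygy_act_exact _ _ _ _ 0 syzK); rewrite addn0.
have [y yE] := exK x Ex.
exists _, (X 1%N), y; split=> //; exact: col_kernel_mul0 (kX 0%N).
Qed.
End ColStep.

(** * Tensor products *)

Section Tensors.
Variables (R : pzRingType) (M : lmodType R^c) (N : lmodType R).

Definition tens (m : M) (n : N) : tensor M N := tensor_class [:: (m, n)].

Lemma tensor_class_cat (s t : seq (M * N)) :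
  tensor_class (s ++ t) = tensor_class s + tensor_class t.
Proof. by rewrite [RHS]tensor_addE. Qed.

Lemma tensor_class_nil : tensor_class [::] = 0 :> tensor M N.
Proof. by []. Qed.

Lemma tensor_class_sum (s : seq (M * N)) :
  tensor_class s = \sum_(p <- s) tens p.1 p.2.
Proof.
elim: s => [|[m n] s IHs]; first by rewrite big_nil.
by rewrite big_cons -IHs -cat1s tensor_class_cat.
Qed.

Lemma tens0l n : tens 0 n = 0.
Proof. by apply/tensor_classP/tens0. Qed.
Lemma tensD1 m m' n : tens (m + m') n = tens m n + tens m' n.
Proof. by rewrite -tensor_class_cat; apply/tensor_classP/tensDl. Qed.
Lemma tensD2 m n n' : tens m (n + n') = tens m n + tens m n'.
Proof. by rewrite -tensor_class_cat; apply/tensor_classP/tensDr. Qed.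
Lemma tens0r m : tens m 0 = 0.
Proof. by apply: (@addrI _ (tens m 0)); rewrite -tensD2 !addr0. Qed.
Lemma tensZ (a : R) m n : tens ((a : R^c) *: m) n = tens m (a *: n).
Proof. by apply/tensor_classP/tensA. Qed.

Lemma tens_suml (I : Type) (r : seq I) (F : I -> M) n :
  tens (\sum_(i <- r) F i) n = \sum_(i <- r) tens (F i) n.
Proof.
exact: (big_morph (fun m => tens m n) (fun a b => tensD1 a b n) (tens0l n)).
Qed.
Lemma tens_sumr (I : Type) (r : seq I) m (F : I -> N) :
  tens m (\sum_(i <- r) F i) = \sum_(i <- r) tens m (F i).
Proof. exact: (big_morph (tens m) (tensD2 m) (tens0r m)). Qed.

(** The universal property of the tensor product, for functions be that are
balanced and biadditive modulo a subgroup S; this avoids forming the quotient by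
S. *)
Lemma tensor_rel_congruence (G : zmodType) (S : G -> Prop) (be : M -> N -> G) :
    S 0 -> (forall x y, S x -> S y -> S (x - y)) ->
    (forall n, S (be 0 n)) ->
    (forall m m' n, S (be (m + m') n - (be m n + be m' n))) ->
    (forall m n n', S (be m (n + n') - (be m n + be m n'))) ->
    (forall (a : R) m n, S (be ((a : R^c) *: m) n - be m (a *: n))) ->
  forall s t, tensor_rel s t ->
  S (\sum_(p <- s) be p.1 p.2 - \sum_(p <- t) be p.1 p.2).
Proof.
move=> S0 SB b0 bDl bDr bA s t.
have SN x : S x -> S (- x) by rewrite -sub0r; apply: (SB).
have SD x y : S x -> S y -> S (x + y).
  by move=> Sx /SN; rewrite -{2}[y]opprK; apply: (SB).
elim=> {s t} [s|s t _|s t u _ IH1 _ IH2|s s' t t' _ IH1 _ IH2|s t|n|m m' n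
  |m n n'|a m n].
- by rewrite subrr.
- by move=> IH; rewrite -opprB; apply: SN.
- by have := SD _ _ IH1 IH2; rewrite subrKA.
- by rewrite !big_cat opprD addrACA; apply: SD.
- by rewrite !big_cat [X in _ - X]addrC subrr.
- by rewrite big_seq1 big_nil subr0; apply: b0.
- by rewrite big_seq1 big_cons big_seq1; apply: bDl.
- by rewrite big_seq1 big_cons big_seq1; apply: bDr.
- by rewrite !big_seq1; apply: bA.
Qed.

End Tensors.

Lemma tensor_map_tens (R : pzRingType) (M M' : lmodType R^c)
  (N N' : lmodType R) (f : {linear M -> M'}) (g : {linear N -> N'}) m n :
  tensor_map f g (tens m n) = tens (f m) (g n).
Proof. by rewrite /tens tensor_mapE. Qed.

Lemma tensor_mapD (R : pzRingType) (M M' : lmodType R^c)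
    (N N' : lmodType R) (f : {linear M -> M'}) (g : {linear N -> N'}) x y :
  tensor_map f g (x + y) = tensor_map f g x + tensor_map f g y.
Proof.
rewrite -[x]tensor_class_repr -[y]tensor_class_repr -tensor_class_cat.
by rewrite !tensor_mapE map_cat tensor_class_cat.
Qed.

Lemma tensor_map0 (R : pzRingType) (M M' : lmodType R^c)
    (N N' : lmodType R) (f : {linear M -> M'}) (g : {linear N -> N'}) :
  tensor_map f g 0 = 0.
Proof. by rewrite -tensor_class_nil tensor_mapE. Qed.

Lemma tensor_map_sum (R : pzRingType) (M M' : lmodType R^c)
    (N N' : lmodType R) (f : {linear M -> M'}) (g : {linear N -> N'})
    (I : Type) (r : seq I) F :
  tensor_map f g (\sum_(i <- r) F i) = \sum_(i <- r) tensor_map f g (F i).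
Proof. exact: (big_morph _ (tensor_mapD f g) (tensor_map0 f g)). Qed.

(** * Flat modules satisfy the equational criterion *)

(** Let I be the column space of E, a right submodule of R^a, and let t be the
element of the tensor product of I and M that is the sum over j of the tensors
of the j-th column of E with x_j. It maps to E x = 0 in M^a, so it is zero by
flatness. Lifting I to R^b sends it to x, up to the subgroup KM of those
families that come from relations between the columns of E; so x is in KM. *)
Lemma flat_lifts_relations (R : pzRingType) (M : lmodType R) :
  flat M -> lifts_relations M.
Proof.
move=> flatM a b E x Ex.
pose Et := (E : 'M[R^c]_(a, b))^T; pose g := mx_linear Et.
have [q surj_q qE] := image_proj g; pose i := image_incl g.
have [l lK] := choice surj_q.
pose t := \sum_j tens (q (delta_mx 0 j)) (x j).
have t0 : t = 0.
  apply: (flatM _ _ i (@image_incl_inj _ _ _ g)).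
  rewrite tensor_map0 tensor_map_sum.
  transitivity (\sum_j \sum_k tens (delta_mx 0 k : 'rV[R^c]_a) (E k j *: x j)).
    apply: eq_bigr => j _; rewrite tensor_map_tens /i qE mx_linearE -rowE /=.
    rewrite [row j _]row_sum_delta tens_suml; apply: eq_bigr => k _.
    by rewrite !mxE tensZ.
  rewrite exchange_big big1 // => k _; rewrite -tens_sumr.
  by have := Ex k; rewrite /act => ->; rewrite tens0r.
pose KM (v : 'I_b -> M) := exists c (D : 'M[R]_(b, c)) (y : 'I_c -> M),
  E *m D = 0 /\ v =1 act D y.
pose be (z : image g) (m : M) : 'I_b -> M := fun j => (l z 0 j : R) *: m.
have KM0 : KM 0.
  exists 0%N, 0, (fun=> 0); split=> [|j]; first by rewrite mulmx0.
  by rewrite act0mx.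
have KMB u v : KM u -> KM v -> KM (u - v).
  move=> [c [D [y [ED uE]]]] [d [C [z [EC vE]]]].
  exists (c + d)%N, (row_mx D (- C)).
  exists (fun k : 'I_(c + d) =>
    match fintype.split k with inl k => y k | inr k => z k end).
  rewrite mul_mx_row ED mulmxN EC oppr0 row_mx0; split=> // j.
  rewrite [LHS]/(u j - v j) uE vE /act big_split_ord /=; congr (_ + _).
    by apply: eq_bigr => k _; rewrite row_mxEl (unsplitK (inl k)).
  rewrite -sumrN; apply: eq_bigr => k _.
  by rewrite row_mxEr (unsplitK (inr k)) mxE scaleNr.
have KMl (r : 'rV[R^c]_b) m : q r = 0 -> KM (fun j => (r 0 j : R) *: m).
  move=> qr; exists 1%N, (r : 'M[R]_(1, b))^T, (fun=> m); split.
    apply: trmx_inj; rewrite trmx0 (@trmx_mul_rev R) trmxK.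
    by rewrite -[LHS]/(g r) -qE qr linear0.
  by move=> j; rewrite /act big_ord1 mxE.
have KMsum (F : 'I_b -> 'I_b -> M) : (forall j, KM (F j)) -> KM (\sum_j F j).
  move=> KF; apply: (big_ind KM KM0) => // u v Ku Kv.
  by rewrite -[v]opprK -[- v]sub0r; apply: (KMB) => //; apply: (KMB).
pose s := [seq (q (delta_mx 0 j), x j) | j <- index_enum 'I_b].
have s0 : tensor_rel s [::].
  by apply/tensor_classP; rewrite tensor_class_sum big_map -/t t0.
have : KM (\sum_(p <- s) be p.1 p.2 - \sum_(p <- [::]) be p.1 p.2).
  apply: tensor_rel_congruence s0 => // [n|m m' n|m n n'|c m n].
  - by apply: KMl; rewrite lK.
  - rewrite (_ : _ - _ = fun j => ((l (m + m') - (l m + l m')) 0 j : R) *: n).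
      by apply: KMl; rewrite linearB linearD !lK subrr.
    apply/funext => j; rewrite !mxE scalerBl scalerDl.
    by [].
  - rewrite (_ : _ - _ = 0) //; apply/funext => j.
    pose c : R := l m 0 j.
    transitivity (c *: (n + n') - (c *: n + c *: n')) => //.
    by rewrite scalerDr subrr.
  - rewrite (_ : _ - _ =
      fun j => ((l ((c : R^c) *: m) - (c : R^c) *: l m) 0 j : R) *: n).
      by apply: KMl; rewrite linearB linearZ !lK subrr.
    by apply/funext => j; rewrite !mxE scalerBl -scalerA.
rewrite big_nil subr0 big_map /= => KMx.
have KMd :
  KM (\sum_j (fun i => ((l (q (delta_mx 0 j)) - delta_mx 0 j) 0 i : R) *: x j)).
  by apply: KMsum => j; apply: KMl; rewrite linearB lK subrr.
have := KMB _ _ KMx KMd; rewrite -sumrB (_ : \sum_j _ = x) //.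
apply/funext => i'; rewrite fct_sumE.
transitivity (\sum_j ((delta_mx 0 j : 'rV[R^c]_b) 0 i' : R) *: x j).
  apply: eq_bigr => j _; rewrite -[LHS]/(_ *: _ - _ *: _) -scalerBl.
  by congr (_ *: _); rewrite !mxE opprB addrC subrK.
rewrite (bigD1 i') //= mxE !eqxx scale1r big1 ?addr0 // => j ji.
by rewrite mxE eqxx eq_sym (negPf ji) scale0r.
Qed.

(** * The equational criterion implies flatness *)

Section FilteredVanishing.
Variables (R : pzRingType) (B : lmodType R^c) (M : lmodType R).
Hypothesis hM : lifts_relations M.

(** The tensor product of B and R^k is B^k; these are the coordinates of the
class of s there. *)
Definition coords k (s : seq (B * 'rV[R]_k)) (j : 'I_k) : B :=
  \sum_(p <- s) (p.2 0 j : R^c) *: p.1.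

Definition eval_rows k (y : 'I_k -> M) (s : seq (B * 'rV[R]_k)) : seq (B * M) :=
  [seq (p.1, comb y p.2) | p <- s].

(** For some map y : R^k -> M, the lists s and t lift to the same element of the
tensor product of B and R^k. A module in which relations lift is a filtered
colimit of such R^k, which is why this is an equivalence relation. *)
Definition same_lift (s t : seq (B * M)) : Prop :=
  exists k (y : 'I_k -> M) (s' t' : seq (B * 'rV[R]_k)),
  [/\ eval_rows y s' = s, eval_rows y t' = t & coords s' =1 coords t'].

Lemma eval_rows_lift (s : seq (B * M)) :
  exists k (y : 'I_k -> M) s', eval_rows y s' = s.
Proof.
exists (size s), (fun i => (tnth (in_tuple s) i).2).
exists [seq ((tnth (in_tuple s) i).1, delta_mx 0 i) | i <- enum 'I_(size s)].
rewrite /eval_rows -map_comp -[RHS](map_tnth_enum (in_tuple s)).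
by apply: eq_map => i /=; rewrite comb_foldE comb_delta -surjective_pairing.
Qed.

Lemma coords_cat k (s t : seq (B * 'rV[R]_k)) j :
  coords (s ++ t) j = coords s j + coords t j.
Proof. exact: big_cat. Qed.

Lemma coords_mul k c (D : 'M[R]_(k, c)) (s : seq (B * 'rV[R]_k)) j :
  coords [seq (p.1, p.2 *m D) | p <- s] j =
  \sum_i (D i j : R^c) *: coords s i.
Proof.
rewrite /coords big_map /=; under [RHS]eq_bigr do rewrite scaler_sumr.
rewrite exchange_big; apply: eq_bigr => p _ /=; rewrite mxE scaler_suml.
by apply: eq_bigr => i _; rewrite scalerA.
Qed.

Lemma eval_rows_mul k c (D : 'M[R]_(k, c)) (z : 'I_c -> M)
    (s : seq (B * 'rV[R]_k)) :
  eval_rows z [seq (p.1, p.2 *m D) | p <- s] = eval_rows (act D z) s.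
Proof.
rewrite /eval_rows -map_comp; apply: eq_map => p /=.
by rewrite !comb_foldE comb_act.
Qed.

Lemma eq_eval_rows k (y z : 'I_k -> M) s :
  y =1 z -> eval_rows y s = eval_rows z s.
Proof. by move=> yz; apply: eq_map => p; rewrite (eq_comb yz). Qed.

(** Two lifts of the same list become equal after mapping R^k and R^l to some
R^c over M: the equalities between their images in M are relations, to be
lifted. *)
Lemma amalgamate k l (y : 'I_k -> M) (z : 'I_l -> M) (s : seq (B * 'rV[R]_k))
    (t : seq (B * 'rV[R]_l)) : eval_rows y s = eval_rows z t ->
  exists c (D : 'M[R]_(k, c)) (C : 'M[R]_(l, c)) (w : 'I_c -> M),
  [/\ y =1 act D w, z =1 act C w &
      [seq (p.1, p.2 *m D) | p <- s] = [seq (p.1, p.2 *m C) | p <- t]].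
Proof.
move=> st; have sz : size t = size s.
  by have := congr1 size st; rewrite !size_map.
pose p0 : B * 'rV[R]_k := (0, 0); pose q0 : B * 'rV[R]_l := (0, 0).
have nth_st i : (i < size s)%N -> (nth p0 s i).1 = (nth q0 t i).1 /\
    comb y (nth p0 s i).2 = comb z (nth q0 t i).2.
  move=> i_s; have := congr1 (fun u => nth (0, 0) u i) st.
  by rewrite /= !(nth_map p0, nth_map q0) ?sz // => -[].
pose E := \matrix_(i < size s) row_mx (nth p0 s i).2 (- (nth q0 t i).2).
pose yz (j : 'I_(k + l)) :=
  match fintype.split j with inl j => y j | inr j => z j end.
have yzl j : yz (lshift l j) = y j by rewrite /yz (unsplitK (inl j)).
have yzr j : yz (rshift k j) = z j by rewrite /yz (unsplitK (inr j)).
have [|c [D [w [ED wE]]]] := @hM _ _ E yz.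
  move=> i; rewrite actE rowK combE big_split_ord /=.
  under eq_bigr do rewrite row_mxEl yzl.
  under [X in _ + X]eq_bigr do rewrite row_mxEr yzr mxE scaleNr.
  by rewrite sumrN -!combE (nth_st i (ltn_ord i)).2 subrr.
exists c, (usubmx D), (dsubmx D), w; split.
- move=> j; rewrite -yzl wE; apply: eq_bigr => m _; by rewrite mxE.
- move=> j; rewrite -yzr wE; apply: eq_bigr => m _; by rewrite mxE.
apply: (@eq_from_nth _ (0, 0)); rewrite !size_map // => i i_s.
rewrite (nth_map p0) // (nth_map q0) ?sz // (nth_st i i_s).1; congr (_, _).
have : row (Ordinal i_s) (E *m D) = 0 by rewrite ED row0.
rewrite row_mul rowK -[D in _ *m D = _]vsubmxK mul_row_col mulNmx.
by move/eqP; rewrite subr_eq0 => /eqP.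
Qed.

Lemma same_lift_trans s t u : same_lift s t -> same_lift t u -> same_lift s u.
Proof.
move=> [k [y [s' [t' [<- <- st]]]]] [l [z [t2 [u' [tz <- tu]]]]].
have [c [D [C [w [yE zE E]]]]] := amalgamate (esym tz).
exists c, w, [seq (p.1, p.2 *m D) | p <- s'], [seq (p.1, p.2 *m C) | p <- u'].
rewrite !eval_rows_mul; split.
- by apply: eq_eval_rows => j; rewrite ?yE ?zE.
- by apply: eq_eval_rows => j; rewrite ?yE ?zE.
move=> j; rewrite !coords_mul; under eq_bigr do rewrite st.
by under [RHS]eq_bigr do rewrite -tu; rewrite -!coords_mul E.
Qed.

Lemma same_lift_cat s s' t t' :
  same_lift s s' -> same_lift t t' -> same_lift (s ++ t) (s' ++ t').
Proof.
move=> [k [y [s1 [s2 [<- <- ss]]]]] [l [z [t1 [t2 [<- <- tt]]]]].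
pose yz (j : 'I_(k + l)) :=
  match fintype.split j with inl j => y j | inr j => z j end.
pose D : 'M[R]_(k, k + l) := row_mx 1%:M 0.
pose C : 'M[R]_(l, k + l) := row_mx 0 1%:M.
have yE : y =1 act D yz.
  move=> j; rewrite actE combE big_split_ord /=.
  rewrite [X in _ + X]big1 ?addr0 => [|m _].
    rewrite -[LHS]comb_delta combE; apply: eq_bigr => m _.
    by rewrite /yz (unsplitK (inl m)) [row _ _ _ _]mxE /D row_mxEl !mxE eq_sym.
  by rewrite mxE /D row_mxEr mxE scale0r.
have zE : z =1 act C yz.
  move=> j; rewrite actE combE big_split_ord /= big1 ?add0r => [|m _].
    rewrite -[LHS]comb_delta combE; apply: eq_bigr => m _.
    by rewrite /yz (unsplitK (inr m)) [row _ _ _ _]mxE /C row_mxEr !mxE eq_sym.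
  by rewrite mxE /C row_mxEl mxE scale0r.
pose ext s t : seq (B * 'rV[R]_(k + l)) :=
  [seq (p.1, p.2 *m D) | p <- s] ++ [seq (p.1, p.2 *m C) | p <- t].
exists (k + l)%N, yz, (ext s1 t1), (ext s2 t2); split.
- by rewrite /eval_rows map_cat; congr (_ ++ _);
    rewrite -/(eval_rows _ _) eval_rows_mul;
    apply: eq_eval_rows => j; rewrite ?yE ?zE.
- by rewrite /eval_rows map_cat; congr (_ ++ _);
    rewrite -/(eval_rows _ _) eval_rows_mul;
    apply: eq_eval_rows => j; rewrite ?yE ?zE.
move=> j; rewrite !coords_cat !coords_mul.
by congr (_ + _); apply: eq_bigr => i _; rewrite ?ss ?tt.
Qed.

Lemma tensor_rel_same_lift s t : tensor_rel s t -> same_lift s t.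
Proof.
elim=> {s t} [s|s t _ [k [y [s' [t' [? ? st]]]]]|s t u _ IH1 _ IH2
  |s s' t t' _ IH1 _ IH2|s t|n|m m' n|m n n'|a m n].
- by have [k [y [s' sE]]] := eval_rows_lift s; exists k, y, s', s'.
- by exists k, y, t', s'; split=> // j; rewrite st.
- exact: same_lift_trans IH1 IH2.
- exact: same_lift_cat.
- have [k [y [s' sE]]] := eval_rows_lift (s ++ t).
  exists k, y, s', (rot (size s) s'); split=> //.
    by rewrite /eval_rows map_rot -/(eval_rows _ _) sE rot_size_cat.
  by move=> j; apply: perm_big; rewrite perm_sym perm_rot.
- exists 1%N, (fun=> n), [:: (0, delta_mx 0 0)], [::]; split=> // [|j].
    by rewrite /eval_rows /= comb_foldE comb_delta.
  by rewrite /coords big_seq1 big_nil scaler0.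
- exists 1%N, (fun=> n), [:: (m + m', delta_mx 0 0)],
    [:: (m, delta_mx 0 0); (m', delta_mx 0 0)]; split=> [||j].
  + by rewrite /eval_rows /= comb_foldE comb_delta.
  + by rewrite /eval_rows /= comb_foldE comb_delta.
  + by rewrite /coords big_seq1 big_cons big_seq1 /= scalerDr.
- have [k [y [s' sE]]] := eval_rows_lift [:: (m, n); (m, n')].
  case: s' sE => [|[m1 r1] [|[m2 r2] [|]]] //= [_ <- _ <-].
  exists k, y, [:: (m, r1 + r2)], [:: (m, r1); (m, r2)]; split=> // [|j].
    by rewrite /eval_rows /= !comb_foldE linearD.
  by rewrite /coords big_seq1 big_cons big_seq1 /= mxE scalerDl.
- exists 1%N, (fun=> n), [:: ((a : R^c) *: m, delta_mx 0 0)],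
    [:: (m, a *: delta_mx 0 0)]; split=> [||j].
  + by rewrite /eval_rows /= comb_foldE comb_delta.
  + by rewrite /eval_rows /= comb_foldE linearZ comb_delta.
  + by rewrite /coords !big_seq1 /= scalerA !mxE.
Qed.

Lemma eval_rows_class k (y : 'I_k -> M) (s : seq (B * 'rV[R]_k)) :
  tensor_class (eval_rows y s) = \sum_j tens (coords s j) (y j).
Proof.
rewrite tensor_class_sum big_map /=.
under [RHS]eq_bigr do rewrite tens_suml.
rewrite exchange_big; apply: eq_bigr => p _; rewrite comb_foldE combE tens_sumr.
by apply: eq_bigr => j _; rewrite tensZ.
Qed.

End FilteredVanishing.

Lemma tensor_mapB (R : pzRingType) (M M' : lmodType R^c)
    (N N' : lmodType R) (f : {linear M -> M'}) (g : {linear N -> N'}) x y :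
  tensor_map f g (x - y) = tensor_map f g x - tensor_map f g y.
Proof.
by apply/eqP; rewrite eq_sym subr_eq -tensor_mapD subrK.
Qed.

(** If the class of s vanishes in the tensor product of B and M, then s lifts to
a list over R^k with zero coordinates in B. These are the images under i of
coordinates in A, so the latter vanish too. *)
Lemma lifts_relations_flat (R : pzRingType) (M : lmodType R) :
  lifts_relations M -> flat M.
Proof.
move=> hM A B i inj_i x1 x2 /eqP; rewrite -subr_eq0 -tensor_mapB => /eqP.
suff inj0 (x : tensor A M) :
    tensor_map i (idfun : {linear M -> M}) x = 0 -> x = 0.
  by move=> /inj0/eqP; rewrite subr_eq0 => /eqP.
rewrite -(tensor_class_repr x) tensor_mapE -tensor_class_nil => /tensor_classP.
move: (repr x) => {x} s /(tensor_rel_same_lift hM)[k [y [s' [t' [sE]]]]].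
case: t' => // _ s'E; have s'0 j : coords s' j = 0.
  by rewrite s'E /coords big_nil.
pose l : seq (A * 'rV[R]_k) := zip (unzip1 s) (unzip2 s').
have sz : size s' = size s by have := congr1 size sE; rewrite !size_map.
have lE : eval_rows y l = s.
  apply: (@eq_from_nth _ (0, 0)).
    by rewrite !size_map size_zip !size_map sz minnn.
  rewrite size_map size_zip !size_map sz minnn => j js.
  rewrite (nth_map (0, 0)) ?size_zip ?size_map ?sz ?minnn //.
  rewrite nth_zip ?size_map //= !(nth_map (0, 0)) ?sz //.
  have := congr1 (fun u => nth (0, 0) u j) sE.
  by rewrite !(nth_map (0, 0)) ?sz //= => -[_ ->]; case: nth.
have coords_l j : coords l j = 0.
  apply: (linear_injE inj_i); rewrite -[RHS](s'0 j) /coords linear_sum.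
  rewrite (big_nth (0, 0)) [RHS](big_nth (0, 0)).
  rewrite size_zip !size_map sz minnn; apply: eq_big_nat => m /andP[_ ms].
  rewrite linearZ nth_zip ?size_map //= !(nth_map (0, 0)) ?sz //.
  have := congr1 (fun u => nth (0, 0) u m) sE.
  by rewrite !(nth_map (0, 0)) ?sz //= => -[-> _].
rewrite -lE eval_rows_class big1 ?tensor_class_nil // => j _.
by rewrite coords_l tens0l.
Qed.

Lemma flatP (R : pzRingType) (M : lmodType R) : flat M <-> lifts_relations M.
Proof. by split; [apply: flat_lifts_relations|apply: lifts_relations_flat]. Qed.

(** * Complete flat resolutions over Ding-Chen rings *)

Section TensorRows.
Variables (R : pzRingType) (I : lmodType R^c).

Lemma tensor_rel_coords k (s t : seq (I * 'rV[R]_k)) :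
  tensor_rel s t -> coords s =1 coords t.
Proof.
move=> st j; apply/eqP; rewrite -subr_eq0; apply/eqP.
pose be (m : I) (r : 'rV[R]_k) : I := (r 0 j : R^c) *: m.
apply: (@tensor_rel_congruence _ _ _ I (fun x => x = 0) be
  _ _ _ _ _ _ _ _ st) => //.
- by move=> x y -> ->; rewrite subrr.
- by move=> n; rewrite /be scaler0.
- by move=> m m' n; rewrite /be scalerDr subrr.
- by move=> m n n'; rewrite /be mxE scalerDl subrr.
- by move=> a m n; rewrite /be mxE scalerA subrr.
Qed.

Lemma tensor_row_class k (s : seq (I * 'rV[R]_k)) :
  tensor_class s = \sum_j tens (coords s j) (delta_mx 0 j).
Proof.
rewrite -eval_rows_class; congr tensor_class.
rewrite /eval_rows -[LHS]map_id; apply: eq_map => p.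
rewrite (comb_basis (idfun : {linear 'rV[R]_k -> 'rV[R]_k})).
exact: surjective_pairing.
Qed.

(** In coordinates, the tensor product of I with the complex of the R^k is the
complex of the I^k, that is, of the right linear maps from the R^k to I; it is
exact because I is injective and the columns are exact. *)
Lemma injective_tensor_exact a b c (D : 'M[R]_(a, b)) (E : 'M[R]_(b, c)) :
  injective_module I -> col_kernel D E ->
  exact (tensor_map (idfun : {linear I -> I}) (mx_linear D))
        (tensor_map (idfun : {linear I -> I}) (mx_linear E)).
Proof.
move=> injI kDE x; split=> [|[y <-]]; last first.
  rewrite -(tensor_class_repr y) !tensor_mapE -map_comp tensor_class_sum.
  rewrite big_map big1 // => p _ /=.
  rewrite -mulmxA (col_kernel_mul0 kDE) mulmx0.
  exact: tens0r.
rewrite -(tensor_class_repr x) tensor_mapE -tensor_class_nil.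
move: (repr x) => {x} s /tensor_classP/tensor_rel_coords sE.
have Es i : act ((E : 'M[R^c]_(b, c))^T) (coords s) i = 0.
  have := sE i; rewrite coords_mul [in RHS]/coords big_nil => <-.
  by apply: eq_bigr => j _; rewrite mxE.
have [y yE] := injective_FPdim injI Logic.I ((col_kernel_tr _ _).1 kDE) Es.
exists (\sum_i tens (y i) (delta_mx 0 i)).
rewrite tensor_map_sum tensor_row_class.
under eq_bigr => i _ do
  rewrite tensor_map_tens /= -rowE [row i D]row_sum_delta tens_sumr.
rewrite exchange_big; apply: eq_bigr => j _ /=; rewrite yE tens_suml.
by apply: eq_bigr => i _; rewrite !mxE tensZ.
Qed.
End TensorRows.

Lemma lifts_relations_row (R : pzRingType) n :
  lifts_relations ('rV[R]_n : lmodType R).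
Proof. exact/lifts_relations_projective/projective_row. Qed.

Section TotallyAcyclic.
Variables (R : pzRingType).
Variables (cohR : left_coherent R) (cohRop : left_coherent R^c).
Variables (n m : nat).
Hypothesis hR : FPdim_le n (R^o : lmodType R).
Hypothesis hRop : FPdim_le m ((R^c)^o : lmodType R^c).

Definition row_step (X : some_mx R) : some_mx R :=
  SomeMx (sval (cid (svalP (cid (coherent_row_kernel cohR X))))).

Lemma row_stepP (X : some_mx R) : row_kernel (row_step X) X.
Proof. exact: svalP (cid (svalP (cid (coherent_row_kernel cohR X)))). Qed.

(** X and Y are consecutive matrices of a complex that is exact both on rows and
on columns. Their sizes match propositionally only, because they will be indexed
by the integers z and z - 1. *)
Definition linked (X Y : some_mx R) : Prop :=
  exists e : ncol X = nrow Y,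
  row_kernel (castmx (erefl, e) (X : 'M_(_, _))) Y /\
  col_kernel (castmx (erefl, e) (X : 'M_(_, _))) Y.

Variable X : some_mx R.
Hypothesis hX : row_syzygy n X.

Local Notation up k := (iter k row_step X).
Local Notation down k := (iter k (col_step cohRop) X).

Lemma row_syzygy_up k : row_syzygy n (up k).
Proof.
elim: k => // k IHk; apply: row_syzygyW.
by exists _, (up k); split=> //; apply: row_stepP.
Qed.

(** Above X, exactness on columns comes from the FP-injective dimension of R as
a left module. *)
Lemma col_kernel_up k : col_kernel (up k.+1) (up k).
Proof.
have kr := @row_stepP (up k); apply/act_exact_regular.
  exact: row_kernel_mul0.
exact: (hR (row_syzygy_up k) kr).
Qed.

(** Each matrix of the complex is preceded by infinitely many others that are
exact on columns, so it is a column syzygy of every order. *)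
Lemma col_syzygy_up j k : row_syzygy j ((up k : 'M[R^c]_(_, _))^T).
Proof.
elim: j k => // j IHj k.
exact: row_syzygy_tr (@col_kernel_up k) (IHj k.+1).
Qed.

Lemma col_syzygy_down j k : row_syzygy j ((down k : 'M[R^c]_(_, _))^T).
Proof.
elim: k j => [|k IHk] j; first exact: (col_syzygy_up j 0).
apply: row_syzygyW; exact: row_syzygy_tr (@col_stepP _ _ (down k)) (IHk j).
Qed.

Lemma linked_up k : linked (up k.+1) (up k).
Proof.
exists erefl; rewrite castmx_id; split; first exact: row_stepP.
exact: col_kernel_up.
Qed.

Lemma linked_down k : linked (down k) (down k.+1).
Proof.
exists erefl; rewrite castmx_id; split; last exact: col_stepP.
have kd := @col_stepP _ cohRop (down k).
exact: (row_kernel_of_col_kernel hRop (col_syzygy_down m k) kd).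
Qed.

(** X is put at index 1, so that its cokernel is the kernel of F_(-1) -> F_(-2).
*)
Definition chain (z : int) : some_mx R :=
  match z with Posz 0 => down 1 | Posz k.+1 => up k | Negz k => down k.+2 end.

Lemma chain_linked z : linked (chain z) (chain (z - 1)).
Proof.
case: z => [[|[|k]]|k].
- exact: (linked_down 1).
- exact: (linked_down 0).
- rewrite (_ : k.+2%:Z - 1 = k.+1%:Z); first exact: linked_up.
  by rewrite -addn1 PoszD addrK.
- rewrite (_ : Negz k - 1 = Negz k.+1); first exact: (linked_down k.+2).
  by rewrite !NegzE -opprD -PoszD addn1.
Qed.

Definition chain_eq z := sval (cid (chain_linked z)).
Definition chain_mx z : 'M[R]_(nrow (chain z), nrow (chain (z - 1))) :=
  castmx (erefl, chain_eq z) (chain z : 'M_(_, _)).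

Lemma cast_col_kernel a b c c' (e : c = c') (E : 'M[R]_(a, b))
    (D : 'M[R]_(b, c)) :
  col_kernel E D -> col_kernel E (castmx (erefl, e) D).
Proof. by case: c' / e; rewrite castmx_id. Qed.
Lemma cast_row_kernel a b c c' (e : c = c') (E : 'M[R]_(a, b))
    (D : 'M[R]_(b, c)) :
  row_kernel E D -> row_kernel E (castmx (erefl, e) D).
Proof. by case: c' / e; rewrite castmx_id. Qed.

Lemma chain_row_kernel z : row_kernel (chain_mx z) (chain_mx (z - 1)).
Proof. exact: cast_row_kernel (svalP (cid (chain_linked z))).1. Qed.
Lemma chain_col_kernel z : col_kernel (chain_mx z) (chain_mx (z - 1)).
Proof. exact: cast_col_kernel (svalP (cid (chain_linked z))).2. Qed.

Lemma row_kernel_exact a b c (E : 'M[R]_(a, b)) (D : 'M[R]_(b, c)) :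
  row_kernel E D -> exact (mx_linear E) (mx_linear D).
Proof.
by move=> kED r; rewrite mx_linearE (kED r); split=> [[s ->]|[s <-]]; exists s.
Qed.

Definition chain_resolution : complete_flat_resolution R :=
  @CompleteFlatResolution R (fun z => 'rV[R]_(nrow (chain z)))
    (fun z => mx_linear (chain_mx z))
    (fun z => lifts_relations_flat (@lifts_relations_row R _))
    (fun z => row_kernel_exact (@chain_row_kernel z))
    (fun I injI z => injective_tensor_exact injI (@chain_col_kernel z)).

Lemma gorenstein_flat_coker : exists (A : lmodType R)
    (q : {linear 'rV[R]_(ncol X) -> A}),
  [/\ gorenstein_flat A, exact (mx_linear X) q & surjective q].
Proof.
pose f := mx_linear (chain_mx (- 1)); pose A := kernel f.
have ex0 : exact (mx_linear (chain_mx 0)) f.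
  exact: row_kernel_exact (@chain_row_kernel 0).
have [|q qE] :=
  factor_inj (f := mx_linear (chain_mx 0)) (@kernel_incl_inj _ _ _ f).
  by move=> x; apply/kernel_exact; apply: (exact_comp0 _ ex0).
exists A, q; split.
- exists chain_resolution, (kernel_incl f); split; last exact: kernel_exact.
  exact: (@kernel_incl_inj _ _ _ f).
- have kX : row_kernel X (chain_mx 0).
    have k0 := @col_stepP _ cohRop X.
    apply: cast_row_kernel.
    exact: (row_kernel_of_col_kernel hRop (col_syzygy_down m 0) k0).
  move=> r; rewrite -(row_kernel_exact kX r) -qE; split=> [->|].
    exact: linear0.
  exact: linear_injE (@kernel_incl_inj _ _ _ f).
move=> k; have [x xE] : exists x, mx_linear (chain_mx 0) x = kernel_incl f k.
  by apply/ex0/kernel_exact; exists k.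
by exists x; apply: (@kernel_incl_inj _ _ _ f); rewrite qE.
Qed.
End TotallyAcyclic.

(** The cokernel of X is Gorenstein flat, so its Ext^1 to C vanishes; this is
the exactness that the dimension bound asks for. *)
Lemma gorenstein_cotorsion_FPdim (R : pzRingType) n m (C : lmodType R) :
    left_coherent R -> left_coherent R^c ->
    FPdim_le n (R^o : lmodType R) -> FPdim_le m ((R^c)^o : lmodType R^c) ->
  gorenstein_cotorsion C -> FPdim_le n C.
Proof.
move=> cohR cohRop hR hRop GC_C a b c Y X hX kYX.
have [A [q [GF_A ex_Xq surj_q]]] :=
  @gorenstein_flat_coker _ cohR cohRop _ _ hR hRop (SomeMx X) hX.
exact: (Ext1_act_exact kYX ex_Xq surj_q (GC_C A GF_A)).
Qed.

(** Z is a cycle further down in the complete resolution of M. The dimension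
does not grow along these cycles, since n bounds it for all flat modules. *)
Lemma gorenstein_flat_syzygy (R : pzRingType) n m (M : lmodType R) :
    left_coherent R -> FPdim_le n (R^o : lmodType R) ->
    gorenstein_flat M -> FPdim_le n M ->
  exists Z : lmodType R, syzygy (@lifts_relations R) m M Z /\ FPdim_le n Z.
Proof.
move=> cohR hR [F [j [inj_j ex_j]]] hM.
pose f k := iter k (fun z : int => z - 1) (-1).
suff H k : exists (Z : lmodType R) (i : {linear Z -> F (f k)}),
    [/\ injective i, exact i (cdiff F (f k)), syzygy (@lifts_relations R) k M Z
      & FPdim_le n Z].
  by have [Z [i [_ _ syzZ hZ]]] := H m; exists Z.
elim: k => [|k [Z [i [inj_i ex_i syzZ hZ]]]]; first by exists M, j.
pose d := cdiff F (f k); pose d' := cdiff F (f k.+1).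
have [|p pE] := factor_inj (f := d) (@kernel_incl_inj _ _ _ d').
  move=> x; apply/kernel_exact; exact: (exact_comp0 _ (@cfr_exact _ F (f k))).
have ses : short_exact i p.
  split=> // [y|z]; first rewrite -ex_i -[cdiff F _ y]pE; last first.
    have [x xE] : exists x, d x = kernel_incl d' z.
      by apply/(@cfr_exact _ F (f k))/kernel_exact; exists z.
    by exists x; apply: (@kernel_incl_inj _ _ _ d'); rewrite pE.
  split=> [->|]; first exact: linear0.
  exact: linear_injE (@kernel_incl_inj _ _ _ d').
have flatF : lifts_relations (F (f k)) by apply/flat_lifts_relations/cfr_flat.
exists (kernel d'), (kernel_incl d'); split.
- exact: (@kernel_incl_inj _ _ _ d').
- exact: kernel_exact.
- by exists Z, (F (f k)), i, p.
apply: (FPdim_le_quotient ses cohR); first exact: lifts_relations_FPdim.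
exact: FPdim_le_leq hZ.
Qed.

(** * Injective modules *)

(** A linear map to E defined on a submodule of B, given by its graph; with
graphs, unions of chains and maps on ideals need no subtypes. *)
Definition functional_submodule (R : pzRingType) (B E : lmodType R)
    (G : B -> E -> Prop) : Prop :=
  [/\ G 0 0,
      forall a x y x' y', G x y -> G x' y' -> G (a *: x + x') (a *: y + y')
    & forall y, G 0 y -> y = 0].

(** The condition of Baer's criterion: linear maps from left ideals of R to E
are given by scaling an element of E. *)
Definition baer (R : pzRingType) (E : lmodType R) : Prop :=
  forall G : R^o -> E -> Prop, functional_submodule G ->
  exists e, forall r y, G r y -> y = (r : R) *: e.

Section FunctionalSubmodule.
Variables (R : pzRingType) (B E : lmodType R) (G : B -> E -> Prop).
Hypothesis hG : functional_submodule G.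

Lemma graphZ a x y : G x y -> G (a *: x) (a *: y).
Proof.
by case: hG => G0 GP _ Gxy; rewrite -[_ *: x]addr0 -[_ *: y]addr0; apply: GP.
Qed.
Lemma graphD x y x' y' : G x y -> G x' y' -> G (x + x') (y + y').
Proof.
by case: hG => _ GP _ Gxy; rewrite -[x]scale1r -[y]scale1r; apply: GP.
Qed.
Lemma graphB x y x' y' : G x y -> G x' y' -> G (x - x') (y - y').
Proof.
by move=> Gxy /(graphZ (-1)); rewrite !scaleN1r; apply: graphD.
Qed.
Lemma graph_sum (I : Type) (r : seq I) (x : I -> B) (y : I -> E) :
  (forall i, G (x i) (y i)) -> G (\sum_(i <- r) x i) (\sum_(i <- r) y i).
Proof.
move=> Gxy; elim: r => [|i r IHr]; first by rewrite !big_nil; case: hG.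
by rewrite !big_cons; apply: graphD.
Qed.
Lemma graph_uniq x y y' : G x y -> G x y' -> y = y'.
Proof.
move=> Gy Gy'; apply/eqP; rewrite -subr_eq0; apply/eqP; case: hG => _ _; apply.
by rewrite -(subrr x); apply: graphB.
Qed.
End FunctionalSubmodule.

Section Baer.
Variables (R : pzRingType) (E : lmodType R) (baerE : baer E).
Variables (A B : lmodType R) (i : {linear A -> B}) (f : {linear A -> E}).
Hypothesis inj_i : injective i.

Definition extends_f (G : B -> E -> Prop) :=
  functional_submodule G /\ forall a, G (i a) (f a).

Let T := {G : B -> E -> Prop | extends_f G}.

Lemma extends_f_base : extends_f (fun x y => exists a, i a = x /\ f a = y).
Proof.
split=> [|a]; last by exists a.
split=> [|c _ _ _ _ [a [<- <-]] [a' [<- <-]]|y [a [ia <-]]].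
- by exists 0; rewrite !linear0.
- by exists (c *: a + a'); rewrite !linearP.
- by rewrite (linear_injE inj_i ia) linear0.
Qed.

Let le (s t : T) : bool := `[< forall x y, sval s x y -> sval t x y >].

Lemma extends_f_maximal : exists t : T, forall s : T,
  (forall x y, sval t x y -> sval s x y) ->
  forall x y, sval s x y -> sval t x y.
Proof.
have [||C totC|t maxt] := @ZL_preorder T (exist _ _ extends_f_base) le.
- by move=> t; apply/asboolP.
- by move=> r s t /asboolP rs /asboolP st; apply/asboolP => x y /rs/st.
- have [[s0 Cs0]|C0] := EM (exists s, C s); last first.
    by exists (exist _ _ extends_f_base) => s Cs; case: C0; exists s.
  pose U x y := exists2 s, C s & sval s x y.
  have common x y x' y' : U x y -> U x' y' ->
      exists2 s, C s & sval s x y /\ sval s x' y'.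
    move=> [s Cs sxy] [t Ct txy].
    have [/asboolP st|/asboolP ts] := totC s t Cs Ct.
      by exists t => //; split=> //; apply: st.
    by exists s => //; split=> //; apply: ts.
  have extU : extends_f U.
    split=> [|a]; last by exists s0 => //; case: (svalP s0).
    split=> [|a x y x' y' Uxy Uxy'|y [s Cs]].
    + by exists s0 => //; case: (svalP s0) => -[].
    + have [s Cs [sxy sxy']] := common _ _ _ _ Uxy Uxy'.
      by exists s => //; case: (svalP s) => -[_ sP _] _; apply: sP.
    + by case: (svalP s) => -[_ _ s0y] _; apply: s0y.
  exists (exist _ U extU) => s Cs; apply/asboolP => x y sxy; by exists s.
exists t => s ts x y sxy.
by have := maxt s; rewrite /le => /(_ (asboolT ts)) /asboolP; apply.
Qed.

Lemma baer_extension : exists g : {linear B -> E}, g \o i =1 f.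
Proof.
have [[G [hG Gf]] /= maxG] := extends_f_maximal.
(* Otherwise G would extend to b, by Baer's condition for the ideal of all r
   such that r b is in the domain of G. *)
have total b : exists y, G b y.
  have [|e eE] := baerE (G := fun r y => G ((r : R) *: b) y).
    case: hG => G0 GP G0y; split=> [|a r y r' y' Gy Gy'|y].
    - by rewrite scale0r.
    - by rewrite scalerDl -scalerA; apply: GP.
    - by rewrite scale0r; apply: G0y.
  exists e.
  pose G' x y := exists (r : R) x' y',
    [/\ G x' y', x = r *: b + x' & y = r *: e + y'].
  have extG' : extends_f G'.
    split=> [|a]; last first.
      by exists 0, (i a), (f a); rewrite !scale0r !add0r; split=> //; apply: Gf.
    split=> [|a _ _ _ _ [r [x [y [Gxy -> ->]]]] [r' [x' [y' [Gxy' -> ->]]]]|].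
    + exists 0, 0, 0; rewrite !scale0r !add0r; split=> //; by case: hG.
    + exists (a * r + r'), (a *: x + x'), (a *: y + y').
      split; first by case: hG => _ GP _; apply: GP.
        by rewrite scalerDr scalerA addrACA -scalerDl.
      by rewrite scalerDr scalerA addrACA -scalerDl.
    + move=> y0 [r [x [y [Gxy /esym/eqP]]]]; rewrite addr_eq0 => /eqP rb ->.
      have Gr : G (r *: b) (- y).
        by rewrite rb -!scaleN1r; apply: graphZ.
      by rewrite -(eE _ _ Gr) addNr.
  apply: (maxG (exist _ G' extG') _ b e) => /= [x y Gxy|].
    by exists 0, x, y; rewrite !scale0r !add0r.
  exists 1, 0, 0; rewrite !scale1r !addr0; split=> //; by case: hG.
have [g gG] := choice total.
have lin_g : linear g.
  move=> a x y; apply: (graph_uniq hG (gG _)).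
  by case: hG => _ GP _; apply: GP.
exists (linear_map lin_g) => a; exact: (graph_uniq hG (gG _) (Gf a)).
Qed.
End Baer.

Lemma baer_injective (R : pzRingType) (E : lmodType R) :
  baer E -> injective_module E.
Proof. by move=> baerE A B i f; apply: baer_extension. Qed.

Definition divisible (D : lmodType int) : Prop :=
  forall (n : int) (x : D), n != 0 -> exists y, n *: y = x.

(** The domain of G is generated by its least positive element n, so that it is
enough to divide by n. *)
Lemma divisible_baer (D : lmodType int) : divisible D -> baer D.
Proof.
move=> divD G hG.
have [[r [y [r0 Gry]]]|no] := EM (exists r y, r != 0 :> int /\ G r y);
  last first.
  exists 0 => r y Gry; rewrite scaler0; have [r0|r0] := eqVneq (r : int) 0.
    by case: hG => _ _; apply; rewrite r0 in Gry.
  by case: no; exists r, y.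
have ex : exists n : nat, (0 < n)%N && `[< exists y, G (n%:Z : int) y >].
  exists `|r|%N; rewrite absz_gt0 r0 /=; apply/asboolP.
  case: r {r0} Gry => k Gry; first by exists y.
  exists (- y); rewrite -scaleN1r.
  have -> : (`|Negz k|%N)%:Z = -1 *: (Negz k : int^o).
    by rewrite scaleN1r NegzE opprK.
  exact: (graphZ hG).
have [n /andP[n_gt0 /asboolP[z Gnz]] n_min] := ex_minnP ex.
have n0 : n%:Z != 0 by rewrite -lt0n.
have [e eE] := divD _ z n0.
exists e => s t Gst; pose q := divz s n; pose u := modz s n.
have su : (s : int) = q * n%:Z + u by apply: divz_eq.
have Gu : G (u : int) (t - q *: z).
  rewrite (_ : u = s - q *: (n%:Z : int^o)).
    by apply: (graphB hG) => //; apply: (graphZ hG).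
  by rewrite su [X in X - _]addrC addrK.
have u0 : u = 0.
  have u_ge0 : 0 <= u by apply: modz_ge0.
  have u_lt : u < n by apply: ltz_pmod.
  case: (u) u_ge0 u_lt Gu => // -[|k] // _.
  rewrite ltz_nat ltnNge => /negP kn Gk.
  by case: kn; apply: n_min; rewrite /=; apply/asboolP; eexists; apply: Gk.
rewrite u0 in Gu; have /eqP := (let: And3 _ _ G0 := hG in G0) _ Gu.
by rewrite subr_eq0 => /eqP ->; rewrite -eE scalerA su u0 addr0.
Qed.

(** * Enough injectives *)

Section Coinduced.
Variables (R : pzRingType) (D : lmodType int).

Definition additive_map (phi : R -> D) : Prop :=
  forall r s, phi (r + s) = phi r + phi s.

Lemma additive_map_submodule : @is_submodule int (R -> D) additive_map.
Proof.
split=> [r s|a phi psi phiD psiD r s]; first by rewrite [RHS]addr0.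
rewrite -[LHS]/(a *: phi (r + s) + psi (r + s)).
rewrite -[RHS]/((a *: phi r + psi r) + (a *: phi s + psi s)).
by rewrite phiD psiD scalerDr addrACA.
Qed.

(** Hom_Z(R, D), where R acts by (a phi)(r) = phi(r a). *)
Definition coinduced : Type := submodule additive_map_submodule.
HB.instance Definition _ := GRing.Zmodule.on coinduced.

Definition coind_fun (phi : coinduced) (r : R) : D :=
  @sub_val _ _ _ additive_map_submodule phi r.
Definition coind_of (phi : R -> D) (h : additive_map phi) : coinduced :=
  @to_sub _ _ _ additive_map_submodule phi h.

Lemma coind_inj (phi psi : coinduced) :
  coind_fun phi =1 coind_fun psi -> phi = psi.
Proof.
move=> E; apply: (@sub_val_inj _ _ _ additive_map_submodule); exact: funext.
Qed.
Lemma coind_funD (phi : coinduced) r s :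
  coind_fun phi (r + s) = coind_fun phi r + coind_fun phi s.
Proof. exact: (@sub_valP _ _ _ additive_map_submodule phi r s). Qed.
Lemma coind_ofE phi (h : additive_map phi) r : coind_fun (coind_of h) r = phi r.
Proof. by []. Qed.
Lemma coind_addE (phi psi : coinduced) r :
  coind_fun (phi + psi) r = coind_fun phi r + coind_fun psi r.
Proof. by []. Qed.

Fact coind_scale_additive (a : R) (phi : coinduced) :
  additive_map (fun r => coind_fun phi (r * a)).
Proof. by move=> r s; rewrite mulrDl coind_funD. Qed.
Definition coind_scale a (phi : coinduced) : coinduced :=
  coind_of (coind_scale_additive a phi).

Fact coind_scaleA a b phi :
  coind_scale a (coind_scale b phi) = coind_scale (a * b) phi.
Proof. by apply: coind_inj => r; rewrite !coind_ofE mulrA. Qed.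
Fact coind_scale1 : left_id 1 coind_scale.
Proof. by move=> phi; apply: coind_inj => r; rewrite coind_ofE mulr1. Qed.
Fact coind_scaleDr : right_distributive coind_scale +%R.
Proof. by move=> a phi psi; apply: coind_inj. Qed.
Fact coind_scaleDl phi : {morph coind_scale^~ phi : a b / a + b}.
Proof.
move=> a b; apply: coind_inj => r.
by rewrite coind_addE !coind_ofE mulrDr coind_funD.
Qed.
HB.instance Definition _ := GRing.Zmodule_isLmodule.Build R coinduced
  coind_scaleA coind_scale1 coind_scaleDr coind_scaleDl.

Lemma coind_scaleE (a : R) (phi : coinduced) r :
  coind_fun (a *: phi) r = coind_fun phi (r * a).
Proof. by []. Qed.

Definition as_int_linear (U V : zmodType) (f : U -> V)
    (fD : forall x y, f (x + y) = f x + f y) : {linear zmodule U -> zmodule V}.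
Proof.
pose g : {additive U -> V} := HB.pack f (GRing.isZmodMorphism.Build U V f
  (fun x y => canRL (addrK _) (etrans (esym (fD _ _)) (congr1 f (subrK y x))))).
refine (@linear_map _ (zmodule U) (zmodule V) f _) => a x y.
by rewrite fD; congr (_ + _); exact: (raddfMz g).
Defined.

(** Maps from A to Hom_Z(R, D) correspond to additive maps from A to D, by
evaluation at 1. *)
Lemma coinduced_injective : injective_module (zmodule D : lmodType int) ->
  injective_module (coinduced : lmodType R).
Proof.
move=> injD A B i f inj_i.
pose f1 := @as_int_linear A D (fun a => coind_fun (f a) 1)
  (fun x y => congr1 (fun phi => coind_fun phi 1) (linearD f x y)).
pose i1 := @as_int_linear A B i (linearD i).
have [h hE] := injD _ _ i1 f1 inj_i.
have hD b c : h (b + c) = h b + h c by apply: (linearD h).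
have add_g (b : B) : additive_map (fun r => h (r *: b) : D).
  by move=> r s; rewrite scalerDl hD.
have lin_g : linear (fun b => coind_of (add_g b)).
  move=> a b c; apply: coind_inj => r.
  by rewrite coind_addE coind_scaleE !coind_ofE scalerDr hD scalerA.
exists (linear_map lin_g) => a; apply: coind_inj => r /=.
rewrite -[LHS]/(h (r *: i a)) -linearZ -[LHS]/((h \o i1) (r *: a)) hE.
by rewrite -[LHS]/(coind_fun (f (r *: a)) 1) linearZ coind_scaleE mul1r.
Qed.

End Coinduced.

Section DivisibleEmbedding.
Variable M : lmodType int.

Let V : lmodType int := zmodule (free_module rat M).
Let kap : {linear free_module int M -> V} :=
  free_sum (fun m : M => basis rat m : V).

Lemma kap_coef x m : coef (kap x : free_module rat M) m = (coef x m)%:~R.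
Proof.
have cD (u v : V) : coef (u + v : V) m = coef u m + coef v m.
  by have := coefP 1 u v m; rewrite scale1r mul1r.
have lin_c : linear (fun u : V => coef u m : zmodule rat).
  move=> a u v; rewrite cD; congr (_ + _).
  pose cf (w : free_module rat M) : rat := coef w m.
  pose cm : {additive free_module rat M -> rat} :=
    HB.pack cf (GRing.isZmodMorphism.Build _ _ cf (fun u v => erefl)).
  exact: (raddfMz cm).
have lin_d : linear (fun x : free_module int M => (coef x m)%:~R : zmodule rat).
  move=> a u v; rewrite coefP rmorphD rmorphM /=.
  by congr (_ + _); rewrite -[RHS]/(_ *~ a) mulrzl.
apply: (@free_linear_ext _ _ _ (linear_map lin_c \o kap)
  (linear_map lin_d)) => y.
rewrite -[LHS]/(coef (kap (basis _ y)) m) /kap free_sum_basis.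
by rewrite -[RHS]/((coef (basis _ y) m)%:~R) !coef_basis; case: eqP.
Qed.

Lemma kap_inj : injective kap.
Proof.
apply: linear_inj0 => x kx; apply: coef_inj => m; apply/eqP.
by rewrite -(intr_eq0 rat) -kap_coef kx.
Qed.

(** M is a quotient of the free abelian group on M; it embeds in the quotient of
the rational vector space on M by the same relations. *)
Lemma divisible_embedding : exists (D : lmodType int) (j : {linear M -> D}),
  divisible D /\ injective j.
Proof.
pose k := kap \o kernel_incl (free_cover M).
exists (cokernel k).
have [|j jE] :=
  factor_surj (f := cokernel_proj k \o kap) (@free_cover_surj _ M).
  move=> x /kernel_exact[y <-]; apply/(@cokernel_exact _ _ _ k); by exists y.
exists j; split.
  move=> n x n0; have [v <-] := @cokernel_proj_surj _ _ _ k x.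
  pose w : free_module rat M := (n%:~R^-1 : rat) *: (v : free_module rat M).
  exists (cokernel_proj k w); rewrite -linearZ; congr (cokernel_proj k _).
  rewrite -[LHS]/(w *~ n) /w -scaler_int scalerA divff ?scale1r //.
  by rewrite intr_eq0.
apply: linear_inj0 => m; have [x <-] := free_cover_surj m.
rewrite jE => /(@cokernel_exact _ _ _ k)[y] /kap_inj <-.
by apply/(@kernel_exact _ _ _ (free_cover M)); exists y.
Qed.
End DivisibleEmbedding.

Lemma enough_injectives (R : pzRingType) (M : lmodType R) :
  exists (E : lmodType R) (i : {linear M -> E}),
  injective_module E /\ injective i.
Proof.
have [D [j [divD inj_j]]] := divisible_embedding (zmodule M).
pose D' : zmodType := D.
have divD' : divisible (zmodule D').
  move=> n x n0; have [y yE] := divD n x n0; exists y; rewrite -yE.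
  by rewrite -[n in RHS]intz scaler_int.
have injE := @coinduced_injective R D (baer_injective (divisible_baer divD')).
have jD x y : j (x + y) = j x + j y by apply: (linearD j).
have addE (m : M) : additive_map (fun r : R => j (r *: m)).
  by move=> r s; rewrite scalerDl jD.
have lin_i : linear (fun m => coind_of (addE m) : coinduced R D).
  move=> a b c; apply: coind_inj => r.
  by rewrite coind_addE coind_scaleE !coind_ofE scalerDr jD scalerA.
exists (coinduced R D), (linear_map lin_i); split=> // x y xy.
have := congr1 (fun phi : coinduced R D => coind_fun phi 1) xy.
by rewrite -[LHS]/(j (1 *: x)) -[RHS]/(j (1 *: y)) !scale1r => /inj_j.
Qed.

(** * Injective dimension over noetherian rings *)

(** Baer's criterion: left ideals are finitely generated, and a linear map on
the ideal generated by the r_k is a family y_k that satisfies the relations Y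
between the r_k. *)
Lemma FPdim0_injective (R : pzRingType) (L : lmodType R) :
    left_noetherian R -> left_coherent R -> FPdim_le 0 L -> injective_module L.
Proof.
move=> noethR cohR hL; apply: baer_injective => G hG.
have subJ : @is_submodule R R^o (fun r => exists y, G r y).
  case: (hG) => G0 GP _; split=> [|a r s [y Gy] [z Gz]]; first by exists 0.
  by exists (a *: y + z); apply: GP.
pose j : {linear submodule subJ -> R^o} := @sub_val _ _ _ subJ.
have [b [p surj_p]] := noethR _ j (@sub_val_inj _ _ _ subJ).
pose r k : R := j (p (delta_mx 0 k)).
have Gr k : exists y, G (r k) y by apply: (@sub_valP _ _ _ subJ).
have [y Gy] := choice Gr; pose X : 'M[R]_(b, 1) := \col_k r k.
have comb_r (s : 'rV[R]_b) : j (p s) = \sum_k s 0 k *: (r k : R^o).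
  rewrite [in LHS](row_sum_delta s) !linear_sum; apply: eq_bigr => k _.
  by rewrite !linearZ.
have [d [Y kYX]] := coherent_row_kernel cohR X.
have [|z zE] := hL _ _ _ Y X Logic.I kYX y.
  move=> i; case: (hG) => _ _; apply.
  rewrite (_ : 0 = \sum_k Y i k *: (r k : R^o)).
    by apply: (graph_sum hG) => k; apply: (graphZ hG).
  have /matrixP/(_ i 0) := row_kernel_mul0 kYX; rewrite !mxE => E.
  by rewrite -[LHS]E; under eq_bigr do rewrite mxE.
exists (z 0) => s t Gst.
have [c cE] := surj_p (@to_sub _ _ _ subJ s (ex_intro _ t Gst)).
have sE : s = \sum_k c 0 k *: (r k : R^o) by rewrite -comb_r cE.
have Gs : G s (\sum_k c 0 k *: y k).
  by rewrite sE; apply: (graph_sum hG) => k; apply: (graphZ hG).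
rewrite (graph_uniq hG Gst Gs) sE scaler_suml; apply: eq_bigr => k _.
by rewrite zE /act big_ord1 mxE scalerA.
Qed.

Fixpoint injdim_le (R : pzRingType) n (M : lmodType R) : Prop :=
  if n is m.+1 then exists (E L : lmodType R) (i : {linear M -> E})
    (p : {linear E -> L}),
    [/\ short_exact i p, injective_module E & injdim_le m L]
  else injective_module M.

Lemma FPdim_injdim (R : pzRingType) n (M : lmodType R) :
  left_noetherian R -> left_coherent R -> FPdim_le n M -> injdim_le n M.
Proof.
move=> noethR cohR; elim: n M => [|n IHn] M hM; first exact: FPdim0_injective.
have [E [i [injE inj_i]]] := enough_injectives M.
exists E, (cokernel i), i, (cokernel_proj i); split=> //.
  exact: cokernel_short_exact.
apply: IHn; apply: (FPdim_le_quotient (cokernel_short_exact inj_i) cohR _ hM).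
exact/(FPdim_le_leq (leq0n n))/injective_FPdim.
Qed.

Section RightResolutionCons.
Variables (R : pzRingType) (M E L : lmodType R).
Variables (i : {linear M -> E}) (p : {linear E -> L}).
Hypothesis ses : short_exact i p.
Variable I : right_resolution L.

Definition rcons_res n : lmodType R := if n is m.+1 then I m else E.
Definition rcons_diff n : {linear rcons_res n -> rcons_res n.+1} :=
  if n is m.+1 then rdiff I m else (raug I \o p).

Lemma rcons_inj : injective i. Proof. by case: ses. Qed.
Lemma rcons_exact0 : exact i (rcons_diff 0).
Proof.
case: ses => _ ex_ip _ y; rewrite -(ex_ip y) /=; split=> [|->].
  exact: linear_injE (@raug_inj _ _ I).
by rewrite linear0.
Qed.
Lemma rcons_exact n : exact (rcons_diff n) (rcons_diff n.+1).
Proof.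
case: n => [|n]; last exact: rdiff_exact.
case: ses => _ _ surj_p y; rewrite (@raug_exact _ _ I y).
split=> [[x <-]|[x <-]]; last by exists (p x).
by have [z <-] := surj_p x; exists z.
Qed.

Definition right_resolution_cons : right_resolution M :=
  @RightResolution R M rcons_res rcons_diff i rcons_inj rcons_exact0
    rcons_exact.
End RightResolutionCons.

Section RightStalk.
Variables (R : pzRingType) (M : lmodType R).

Lemma idfun_inj : injective (idfun : {linear M -> M}). Proof. by []. Qed.
Lemma rstalk_exact0 : exact (idfun : {linear M -> M})
  (\0 : {linear stalk M 0 -> stalk M 1}).
Proof. by move=> y; split=> // _; exists y. Qed.
Lemma rstalk_exact n : exact (\0 : {linear stalk M n -> stalk M n.+1})
  (\0 : {linear stalk M n.+1 -> stalk M n.+2}).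
Proof. by move=> y; split=> // _; exists 0; rewrite (stalk0 y). Qed.

Definition right_stalk_resolution : right_resolution M :=
  @RightResolution R M (stalk M) (fun n => \0) idfun idfun_inj rstalk_exact0
    rstalk_exact.
End RightStalk.

Lemma injective_zero (R : pzRingType) :
  injective_module ('rV[R]_0 : lmodType R).
Proof. by move=> A B i f _; exists \0 => x; rewrite /= [RHS]thinmx0. Qed.

Lemma injdim_finite (R : pzRingType) n (M : lmodType R) :
  injdim_le n M -> finite_injective_dim M.
Proof.
elim: n M => [|n IHn] M.
  move=> injM; exists 0%N, (right_stalk_resolution M).
  by split=> [[|j]|[|j]] //; [apply: injective_zero|move=> _ x; apply: thinmx0].
move=> [E [L [i [p [ses injE /IHn[m [I [injI I0]]]]]]]].
exists m.+1, (right_resolution_cons ses I); split=> [[|j]|[|j]] //.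
  exact: injI.
exact: I0.
Qed.

Section RightTail.
Variables (R : pzRingType) (M : lmodType R) (I : right_resolution M).

Lemma rtail_aug_exists : exists g : {linear cokernel (raug I) -> I 1%N},
  forall x, g (cokernel_proj (raug I) x) = rdiff I 0 x.
Proof.
apply: factor_surj; first exact: (@cokernel_proj_surj _ _ _ (raug I)).
move=> x /(@cokernel_exact _ _ _ (raug I))[y <-].
exact: (exact_comp0 _ (@raug_exact _ _ I)).
Qed.
Definition rtail_aug := sval (cid rtail_aug_exists).
Lemma rtail_augE x : rtail_aug (cokernel_proj (raug I) x) = rdiff I 0 x.
Proof. exact: svalP (cid rtail_aug_exists) x. Qed.

Lemma rtail_inj : injective rtail_aug.
Proof.
apply: linear_inj0 => u; have [x <-] := @cokernel_proj_surj _ _ _ (raug I) u.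
by rewrite rtail_augE => /(@raug_exact _ _ I)/cokernel_exact.
Qed.
Lemma rtail_exact : exact rtail_aug (rdiff I 1).
Proof.
move=> y; rewrite (@rdiff_exact _ _ I 0 y); split=> [[x <-]|[u <-]].
  by exists (cokernel_proj (raug I) x); rewrite rtail_augE.
have [x <-] := @cokernel_proj_surj _ _ _ (raug I) u.
by exists x; rewrite rtail_augE.
Qed.
Definition right_resolution_tail : right_resolution (cokernel (raug I)) :=
  @RightResolution R _ (fun n => I n.+1) (fun n => rdiff I n.+1) rtail_aug
    rtail_inj rtail_exact (fun n => @rdiff_exact _ _ I n.+1).
End RightTail.

Lemma finite_injective_FPdim (R : pzRingType) (M : lmodType R) :
  finite_injective_dim M -> exists n, FPdim_le n M.
Proof.
move=> [n [I [injI I0]]]; elim: n M I injI I0 => [|n IHn] M I injI I0.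
  (* I 1 is the zero module, and a first cosyzygy of M. *)
  exists 1%N; have ses : short_exact (raug I) (rdiff I 0).
    split; [exact: raug_inj|exact: raug_exact|].
    by move=> y; exists 0; rewrite (I0 1%N isT y) linear0.
  apply: (FPdim_le_sub ses); last exact: injective_FPdim.
  exact/(FPdim_le_leq (leq0n 1))/injective_FPdim.
have [||m hm] := IHn _ (right_resolution_tail I).
- by move=> j; apply: injI.
- by move=> j nj x; apply: (I0 j.+1).
exists m.+1.
apply: (FPdim_le_sub (cokernel_short_exact (@raug_inj _ _ I)) _ hm).
exact/(FPdim_le_leq (leq0n _))/injective_FPdim.
Qed.

(** * Projective dimension *)

(** This is Ext^(j+1)(M, L) = 0. The syzygies of M and the cosyzygies of L are
shifted together: a map f from the (j+1)-st syzygy to L extends to E, and the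
obstruction to landing in L is a map from the j-th syzygy to L'. *)
Lemma injdim_extend (R : pzRingType) (M : lmodType R) j (L : lmodType R) :
    injdim_le j L -> forall f : {linear free_syzygy M j.+1 -> L},
  exists g : {linear free_res M j -> L},
    g \o kernel_incl (free_cover (free_syzygy M j)) =1 f.
Proof.
elim: j L => [|j IHj] L.
  by move=> injL f; apply: injL; apply: (@kernel_incl_inj _ _ _ (free_cover M)).
move=> [E [L' [i [p [[inj_i ex_ip surj_p] injE injL']]]]] f.
set K := free_syzygy M j.+1; pose c := free_cover K.
have [g gE] := injE _ _ (kernel_incl c) (i \o f) (@kernel_incl_inj _ _ _ c).
have [|h hE] := factor_surj (f := p \o g) (@free_cover_surj _ K).
  move=> x /(@kernel_exact _ _ _ c)[k <-]; rewrite -[LHS]/(p ((g \o _) k)) gE.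
  exact: (exact_comp0 _ ex_ip).
have [h1 h1E] := IHj _ injL' h.
have [h2 h2E] := @projective_free R _ _ _ p h1 surj_p.
pose e := kernel_incl (free_cover (free_syzygy M j)) \o c.
have [|e' e'E] := factor_inj (f := g \- (h2 \o e)) inj_i.
  move=> x; apply/ex_ip; rewrite /= linearB -[p (h2 _)]/((p \o h2) _) h2E.
  by rewrite -[h1 _]/((h1 \o _) (c x)) h1E hE subrr.
exists e' => k; have ck0 : c (kernel_incl c k) = 0.
  exact: (exact_comp0 _ (@kernel_exact _ _ _ c)).
apply: inj_i; rewrite -[LHS]/(i (e' (kernel_incl c k))) e'E.
rewrite -[LHS]/((g \o _) k - h2 (kernel_incl _ (c (kernel_incl c k)))) gE ck0.
by rewrite (linear0 (kernel_incl _)) (linear0 h2) subr0.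
Qed.

Lemma projective_retract (R : pzRingType) (P F : lmodType R)
    (i : {linear P -> F}) (p : {linear F -> P}) :
  p \o i =1 id -> projective F -> projective P.
Proof.
move=> pi projF A B q f surj_q; have [g gE] := projF _ _ q (f \o p) surj_q.
exists (g \o i) => x; rewrite -[LHS]/((q \o g) (i x)) gE.
by rewrite -[LHS]/(f ((p \o i) x)) pi.
Qed.

(** The identity of the (n+1)-st syzygy extends to the free module that contains
it, so the sequence of the n-th syzygy splits. *)
Lemma projective_free_syzygy (R : pzRingType) (M : lmodType R) n :
  injdim_le n (free_syzygy M n.+1) -> projective (free_syzygy M n).
Proof.
move=> injK; set c := free_cover (free_syzygy M n).
have [r rE] := injdim_extend injK idfun.
have [|s sE] := factor_surj (f := idfun \- (kernel_incl c \o r))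
  (@free_cover_surj _ (free_syzygy M n)).
  move=> x /(@kernel_exact _ _ _ c)[k <-].
  by rewrite /= -[r _]/((r \o _) k) rE subrr.
apply: (@projective_retract _ _ _ s c) => [x|]; last exact: projective_free.
have [y <-] := free_cover_surj x; rewrite -[LHS]/(c (s (c y))) sE.
rewrite -[LHS]/(c (y - kernel_incl c (r y))) linearB.
rewrite (_ : c (kernel_incl c _) = 0) ?subr0 //.
exact: (exact_comp0 _ (@kernel_exact _ _ _ c)).
Qed.

(** * Modules of finite dimension over a Ding-Chen ring *)

Lemma finite_FP_injective_dimP (R : pzRingType) (M : lmodType R) :
  left_coherent R -> finite_FP_injective_dim M <-> exists n, FPdim_le n M.
Proof.
move=> cohR; split=> [[n hM]|[n hM]]; exists n; first exact: FPdim_le_Ext.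
exact: Ext_FPdim_le.
Qed.

Section DingChen.
Variables (R : pzRingType) (n m : nat).
Hypotheses (cohR : left_coherent R) (cohRop : left_coherent R^c).
Hypothesis hR : FPdim_le n (R^o : lmodType R).
Hypothesis hRop : FPdim_le m ((R^c)^o : lmodType R^c).

Lemma flat_syzygyP k (K M : lmodType R) :
  syzygy (@flat R) k K M <-> syzygy (@lifts_relations R) k K M.
Proof. by split; apply: syzygyW => F /flatP. Qed.

Lemma FPdim_of_finite_flat_dim (M : lmodType R) :
  finite_flat_dim M -> FPdim_le n M.
Proof.
move=> /syzygy_of_finite_left_dim[k [K [flatK /flat_syzygyP syzK]]].
apply: (FPdim_of_flat_syzygy cohR hR syzK); apply: lifts_relations_FPdim => //.
exact/flatP.
Qed.

Lemma finite_flat_dim_of_FPdim k (M : lmodType R) :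
  FPdim_le k M -> finite_flat_dim M.
Proof.
move=> hM; have syzK := free_syzygy_syzygy M m.
have flatK : flat (free_syzygy M m).
  apply/flatP/(flat_syzygy_of_FPdim cohRop hRop hM).
  exact: syzygyW (@lifts_relations_projective R) syzK.
apply: (finite_left_dim_of_syzygy _ flatK).
  exact/flatP/lifts_relations_row.
by apply: syzygyW syzK => F /lifts_relations_projective/flatP.
Qed.

Lemma FPdim_uniform k (M : lmodType R) : FPdim_le k M -> FPdim_le n M.
Proof. by move=> /finite_flat_dim_of_FPdim/FPdim_of_finite_flat_dim. Qed.

(** M is an m-th flat syzygy of a module of finite FP-injective dimension. *)
Lemma gorenstein_flat_FPdim_flat k (M : lmodType R) :
  gorenstein_flat M -> FPdim_le k M -> flat M.
Proof.
move=> GF_M /FPdim_uniform hM; apply/flatP.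
have [Z [syzZ hZ]] := gorenstein_flat_syzygy m cohR hR GF_M hM.
exact: flat_syzygy_of_FPdim hRop hZ syzZ.
Qed.

(** All syzygies of M have dimension at most n, so injective dimension at most
n; hence Ext^(n+1) from M to its (n+1)-st syzygy vanishes and the n-th syzygy is
projective. *)
Lemma finite_projective_dim_of_FPdim (M : lmodType R) :
  left_noetherian R -> FPdim_le n M -> finite_projective_dim M.
Proof.
move=> noethR hM.
have hK k : FPdim_le n (free_syzygy M k).
  elim: k => // k IHk; apply: (@FPdim_uniform n.+1).
  apply: (FPdim_le_sub (kernel_short_exact (@free_cover_surj _ _)) _ IHk).
  apply: (FPdim_le_leq (leqnSn n)); apply: lifts_relations_FPdim => //.
  exact: lifts_relations_free.
have projK : projective (free_syzygy M n).
  exact/projective_free_syzygy/FPdim_injdim.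
have syzK := free_syzygy_syzygy M n.
exact: finite_left_dim_of_syzygy (@projective_row R 0) projK syzK.
Qed.

(** * Trivial objects *)

Variable ms : model_structure R.
Hypothesis gfms : gorenstein_flat_model_structure ms.

(** X is a cofibrant replacement of M: it is obtained by factoring 0 -> M into a
cofibration and a trivial fibration, and p is a weak equivalence. *)
Lemma cofibrant_replacement (M : lmodType R) :
  exists (K X : lmodType R) (i : {linear K -> X}) (p : {linear X -> M}),
  [/\ short_exact i p, gorenstein_flat X, gorenstein_cotorsion K &
      (trivial_object ms M <-> trivial_object ms X)].
Proof.
have [abel cls] := gfms.
have [X [j [p [cof_j tfib_p jpE]]]] := cof_tfib_factorization ms (from_zero M).
have j0 : j = from_zero X.
  by apply: linear_ext => x; rewrite [x]thinmx0 !linear0.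
have [_ _ _ [/(_ tfib_p)[K [i [ses tfK]]] _]] := abel _ _ p.
exists K, X, i, p; split=> //.
- by have [cofX _ _ _] := cls X; apply/cofX; rewrite /cofibrant -j0.
- by have [_ _ _ tfibK] := cls K; apply/tfibK.
have [_ w_p] := tfib_p.
have hjp : from_zero M =1 p \o from_zero X by rewrite -j0.
have [H1 _ H3] := weq_two_of_three ms hjp.
by split=> [w_M|w_X]; [apply: H3|apply: H1].
Qed.

(** In the replacement 0 -> K -> X -> M -> 0, the module K is Gorenstein
cotorsion, hence of finite FP-injective dimension. So M and X have finite
dimension simultaneously; and X, being Gorenstein flat, is then flat, that is,
trivial. *)
Lemma trivial_object_finite_flat_dim (M : lmodType R) :
  trivial_object ms M <-> finite_flat_dim M.
Proof.
have [K [X [i [p [ses GF_X GC_K trivMX]]]]] := cofibrant_replacement M.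
have hK := gorenstein_cotorsion_FPdim cohR cohRop hR hRop GC_K.
have [abel cls] := gfms; have [cofX _ flatX _] := cls X.
rewrite trivMX; split=> [trivX|fdM].
  have /flatP flX : flat X by apply/flatX; split=> //; apply/cofX.
  apply: (@finite_flat_dim_of_FPdim n); apply: (FPdim_le_quotient ses cohR).
    exact: lifts_relations_FPdim.
  exact: FPdim_le_leq hK.
have hX : FPdim_le n X.
  exact: (FPdim_le_ext ses hK (FPdim_of_finite_flat_dim fdM)).
by have /flatX[] : flat X by apply: gorenstein_flat_FPdim_flat hX.
Qed.

End DingChen.

Theorem corollary3p5 (R : pzRingType) (hR : ding_chen R) (M : lmodType R) :
  [/\ forall ms : model_structure R, gorenstein_flat_model_structure ms ->
        (trivial_object ms M <-> finite_flat_dim M),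
      finite_flat_dim M <-> finite_FP_injective_dim M
    & gorenstein R ->
        (finite_flat_dim M <-> finite_injective_dim M) /\
        (finite_flat_dim M <-> finite_projective_dim M)].
Proof.
have [cohR cohRop /(finite_FP_injective_dimP _ cohR)[n hn]
  /(finite_FP_injective_dimP _ cohRop)[m hm]] := hR.
split=> [ms gfms||[noethR _ _ _]].
- exact: (trivial_object_finite_flat_dim cohR cohRop hn hm gfms).
- rewrite finite_FP_injective_dimP //; split=> [fdM|[k hM]].
    exists n; exact: FPdim_of_finite_flat_dim.
  exact: (finite_flat_dim_of_FPdim cohRop hm hM).
split; split=> [fdM|].
- have hM := FPdim_of_finite_flat_dim cohR hn fdM.
  exact: injdim_finite (FPdim_injdim noethR cohR hM).
- move=> /finite_injective_FPdim[k hM].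
  exact: (finite_flat_dim_of_FPdim cohRop hm hM).
- have hM := FPdim_of_finite_flat_dim cohR hn fdM.
  exact: (finite_projective_dim_of_FPdim cohR cohRop hn hm noethR hM).
move=> [k [P [projP P0]]]; exists k, P; split=> // i.
exact/flatP/lifts_relations_projective.
Qed.
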